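(* For every prime $p>0$ there exists a complete non-Archimedean field $(k,|\cdot|)$ of characteristic $p$ (with nontrivial value group) such that for every integer $n>0$ the Tate algebra $T_n(k)=k\{X_1,\dots,X_n\}$ admits no nonzero $T_n(k)$-linear map $F_{T_n(k)*}T_n(k)\to T_n(k)$. In particular, $T_n(k)$ is not Frobenius split for any $n>0$.
   Context: A non-Archimedean field $(k,|\cdot|)$ is a field $k$ with a map $|\cdot|\colon k\to\mathbb{R}_{\ge0}$ such that $|x|=0$ iff $x=0$, $|x+y|\le\max\{|x|,|y|\}$, $|xy|=|x||y|$; here it is assumed complete for the metric $|x-y|$ and with value group $|k^\times|\neq\{1\}$. The Tate algebra $T_n(k)=k\{X_1,\dots,X_n\}$ is the subring of $k[[X_1,\dots,X_n]]$ consisting of series $\sum_{\nu\in\mathbb{Z}_{\ge0}^n}a_\nu X^\nu$ with $|a_\nu|\to0$ as $\nu_1+\dots+\nu_n\to\infty$. For a ring $R$ of characteristic $p$, $F_{R*}R$ denotes $R$ viewed as an $R$-module via $r\cdot x=r^px$; an $R$-linear map $F_{R*}R\to R$ is called a $p^{-1}$-linear map, and $R$ is Frobenius split if there is a $p^{-1}$-linear map sending $1$ to $1$. *)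

(* Defs.v *)
From Stdlib Require Import Reals.
From HB Require Import structures.
From mathcomp Require Import all_boot all_order all_algebra.
Set Implicit Arguments.
Unset Strict Implicit.
Unset Printing Implicit Defensive.
Import GRing.Theory.
Local Open Scope ring_scope.

Definition is_nonarch_abs (k : fieldType) (abs : k -> R) : Prop :=
  (forall x : k, Rle R0 (abs x)) /\
  (forall x : k, abs x = R0 <-> x = 0) /\
  (forall x y : k, Rle (abs (x + y)) (Rmax (abs x) (abs y))) /\
  (forall x y : k, abs (x * y) = Rmult (abs x) (abs y)).

Definition abs_complete (k : fieldType) (abs : k -> R) : Prop :=
  forall u : nat -> k,
    (forall eps, Rlt R0 eps -> exists N : nat, forall m n : nat,
        (N <= m)%N -> (N <= n)%N -> Rlt (abs (u m - u n)) eps) ->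
    exists l : k, forall eps, Rlt R0 eps -> exists N : nat, forall n : nat,
        (N <= n)%N -> Rlt (abs (u n - l)) eps.

Definition abs_nontrivial (k : fieldType) (abs : k -> R) : Prop :=
  exists x : k, x <> 0 /\ abs x <> R1.

Definition multi (n : nat) := {ffun 'I_n -> nat}.
Definition series (k : fieldType) (n : nat) := multi n -> k.
Definition mdeg (n : nat) (nu : multi n) : nat := (\sum_(i < n) nu i)%N.

Definition tate (k : fieldType) (abs : k -> R) (n : nat) (f : series k n) : Prop :=
  forall eps, Rlt R0 eps -> exists N : nat, forall nu : multi n,
      (N <= mdeg nu)%N -> Rlt (abs (f nu)) eps.

Definition szero (k : fieldType) (n : nat) : series k n := fun _ => 0.
Definition sone (k : fieldType) (n : nat) : series k n :=
  fun nu => if [forall i, nu i == 0%N] then 1 else 0.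
Definition sadd (k : fieldType) (n : nat) (f g : series k n) : series k n :=
  fun nu => f nu + g nu.
Definition smul (k : fieldType) (n : nat) (f g : series k n) : series k n :=
  fun nu => \sum_(mu : {ffun 'I_n -> 'I_(mdeg nu).+1} | [forall i, (mu i <= nu i)%N])
      f (finfun (fun i : 'I_n => nat_of_ord (mu i)) : multi n) *
      g (finfun (fun i : 'I_n => (nu i - mu i)%N) : multi n).
Definition spow (k : fieldType) (n : nat) (f : series k n) (m : nat) : series k n :=
  iter m (smul f) (@sone k n).

(* phi : F_* T_n(k) -> T_n(k) is T_n(k)-linear (a p^{-1}-linear map):
   it maps T_n(k) to T_n(k), is additive, and phi (r^p x) = r phi(x). *)
Definition p_inv_linear (k : fieldType) (abs : k -> R) (n p : nat)
    (phi : series k n -> series k n) : Prop :=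
  (forall x, tate abs x -> tate abs (phi x)) /\
  (forall x y, tate abs x -> tate abs y -> phi (sadd x y) = sadd (phi x) (phi y)) /\
  (forall r x, tate abs r -> tate abs x ->
      phi (smul (spow r p) x) = smul r (phi x)).

Definition frobenius_split (k : fieldType) (abs : k -> R) (n p : nat) : Prop :=
  exists phi : series k n -> series k n,
    p_inv_linear abs p phi /\ phi (@sone k n) = @sone k n.

(* Main.v *)
Require Import Defs.
From Stdlib Require Import ZArith Reals Lra Classical FunctionalExtensionality.
From HB Require Import structures.
From mathcomp Require Import all_boot all_order all_algebra zify boolp.
From mathcomp Require filter mpoly ring.
(** Let [L] be a spherically complete valued field of characteristic [p] with contractive
    derivations [D_j] and elements [X_j] of norm at most [1] such that [D_i X_j = delta_ij].
    Then [k = {u | D_j u -> 0}] is a closed subfield of [L] containing [L^p].  A nonzero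
    [p^-1]-linear map on [T_n(k)] yields, by restricting it to multiples of one series, reading
    off one coefficient and precomposing with the Frobenius, a nonzero [k]-linear map
    [F : L -> k]; a gliding hump argument in the powers of [X_1] shows that [F] is bounded.
    As [L] is spherically complete, so would be its quotient [k]; but sums [sum_i X_i t_i] with
    [|t_i|] strictly decreasing to a positive limit have no pseudo-limit in [k].

    [L] is the ultralimit of the fields [F_p(x_0, .., x_n)] with [|f| = exp (deg f / (n + 1))]
    and the partial derivatives: bounded sequences modulo null sequences along a free
    ultrafilter.  Spherical completeness is a diagonal argument, and rescaling the degree by
    [n + 1] makes the value group all of the positive reals. *)

Set Implicit Arguments.
Unset Strict Implicit.
Unset Printing Implicit Defensive.
Import GRing.Theory.
Local Open Scope ring_scope.
Delimit Scope R_scope with Re.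

(** * Non-Archimedean absolute values *)

Section NonarchAbs.
Variables (k : fieldType) (abs : k -> R).
Hypothesis absP : is_nonarch_abs abs.

Lemma abs_ge0 x : (0 <= abs x)%Re.
Proof. by case: absP. Qed.

Lemma abs0 : abs 0 = 0%Re.
Proof. by case: absP => _ [h _]; apply/h. Qed.

Lemma abs_eq0 x : abs x = 0%Re -> x = 0.
Proof. by case: absP => _ [h _] /h. Qed.

Lemma abs_gt0 x : x <> 0 -> (0 < abs x)%Re.
Proof. by move=> x0; case: (abs_ge0 x) => // /esym/abs_eq0. Qed.

Lemma absM x y : abs (x * y) = (abs x * abs y)%Re.
Proof. by case: absP => _ [_ [_ h]]. Qed.

Lemma absD x y : (abs (x + y) <= Rmax (abs x) (abs y))%Re.
Proof. by case: absP => _ [_ [h _]]. Qed.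

Lemma abs1 : abs 1 = 1%Re.
Proof.
have := absM 1 1; rewrite mulr1 => e.
have /abs_gt0 h : (1 : k) <> 0 by apply/eqP/oner_neq0.
by apply: (Rmult_eq_reg_l (abs 1)); lra.
Qed.

Lemma absN x : abs (- x) = abs x.
Proof.
have h : abs (-1) = 1%Re.
  have := absM (-1) (-1); rewrite mulrNN mulr1 abs1 => e.
  by have := abs_ge0 (-1); nra.
by rewrite -mulN1r absM h Rmult_1_l.
Qed.

Lemma absB_sym x y : abs (x - y) = abs (y - x).
Proof. by rewrite -absN opprB. Qed.

Lemma absD_le x y r : (abs x <= r)%Re -> (abs y <= r)%Re -> (abs (x + y) <= r)%Re.
Proof. by move=> hx hy; apply: Rle_trans (absD x y) _; apply: Rmax_lub. Qed.

Lemma absB_le x y r : (abs x <= r)%Re -> (abs y <= r)%Re -> (abs (x - y) <= r)%Re.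
Proof. by move=> hx hy; apply: absD_le; rewrite ?absN. Qed.

Lemma absD_lt x y r : (abs x < r)%Re -> (abs y < r)%Re -> (abs (x + y) < r)%Re.
Proof. by move=> hx hy; apply: Rle_lt_trans (absD x y) _; apply: Rmax_lub_lt. Qed.

(** If [x + y] were smaller than [y], then [y], as the difference of [x + y] and [x], would be
    smaller than itself. *)
Lemma absD_dominant x y : (abs x < abs y)%Re -> abs (x + y) = abs y.
Proof.
move=> h; apply: Rle_antisym; first by apply: absD_le; lra.
apply: Rnot_lt_le => h2.
have /absB_le/(_ (Rmax_r (abs (x + y)) (abs x))) := Rmax_l (abs (x + y)) (abs x).
by rewrite addrC addKr; have := Rmax_lub_lt _ _ _ h2 h; lra.
Qed.

Lemma absX x m : abs (x ^+ m) = (abs x ^ m)%Re.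
Proof. by elim: m => [|m IH]; rewrite ?expr0 ?abs1 // exprS absM IH. Qed.

Lemma absV x : x <> 0 -> abs x^-1 = (/ abs x)%Re.
Proof.
move=> x0; have h := abs_gt0 x0; apply: (Rmult_eq_reg_l (abs x)); last by lra.
by rewrite -absM divff ?abs1; [rewrite Rinv_r //; lra | apply/eqP].
Qed.

End NonarchAbs.

(** * Automatic continuity of p^-1-linear maps *)

Section Shift.
Variables (k : fieldType) (n : nat) (i0 : 'I_n).
Implicit Types (nu : multi n) (x : series k n).

(** The subtraction is truncated, so [mlow d nu] is only meaningful for [d <= nu i0]; [shift] tests
    this before using it. *)
Definition mlow d (nu : multi n) : multi n :=
  [ffun i => if i == i0 then (nu i - d)%N else nu i].
Definition mup d (nu : multi n) : multi n :=
  [ffun i => if i == i0 then (nu i + d)%N else nu i].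
Definition monoX (c : k) d : series k n :=
  fun nu => if nu == mup d [ffun=> 0%N] then c else 0.
Definition shift d (x : series k n) : series k n :=
  fun nu => if (d <= nu i0)%N then x (mlow d nu) else 0.
Definition scale (a : k) (x : series k n) : series k n := fun nu => a * x nu.

Lemma mdegD1 (nu : multi n) : mdeg nu = (nu i0 + \sum_(i < n | i != i0) nu i)%N.
Proof. by rewrite /mdeg (bigD1 i0). Qed.

Lemma mdeg_mlow d nu : (d <= nu i0)%N -> (mdeg (mlow d nu) + d)%N = mdeg nu.
Proof.
move=> h; rewrite !mdegD1 ffunE eqxx addnAC subnK //; congr addn.
by apply: eq_bigr => i /negPf ni; rewrite ffunE ni.
Qed.

Lemma mdeg_mup d nu : mdeg (mup d nu) = (mdeg nu + d)%N.
Proof.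
rewrite !mdegD1 ffunE eqxx addnAC; congr (_ + _ + _)%N.
by apply: eq_bigr => i /negPf ni; rewrite ffunE ni.
Qed.

(** Only one term of the convolution survives, the one whose first index [mu0] is the exponent of
    the monomial; if [d] exceeds [nu i0], this index is out of range and the sum is empty of nonzero
    terms. *)
Lemma smul_monoX c d x : smul (monoX c d) x = scale c (shift d x).
Proof.
apply: functional_extensionality => nu; rewrite /smul /scale /shift.
have sub_mdeg : (nu i0 <= mdeg nu)%N by rewrite mdegD1 leq_addr.
have monoE (mu : {ffun 'I_n -> 'I_(mdeg nu).+1}) :
    monoX c d [ffun i => nat_of_ord (mu i)] <> 0 ->
    forall i, mu i = (if i == i0 then d else 0%N) :> nat.
  rewrite /monoX; case: eqP => // /ffunP h _ i.
  by have := h i; rewrite !ffunE; case: ifP.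
case: ifP => hd; last first.
  rewrite big1 ?mulr0 // => mu /forallP/(_ i0) hmu; apply/eqP.
  rewrite mulf_eq0; apply/orP; left; apply/eqP; apply: NNPP => h0.
  have := monoE _ h0 i0; rewrite eqxx => e;  by rewrite e hd in hmu.
pose mu0 : {ffun 'I_n -> 'I_(mdeg nu).+1} := [ffun i => inord (if i == i0 then d else 0)].
have mu0E i : mu0 i = (if i == i0 then d else 0%N) :> nat.
  by rewrite ffunE inordK //; case: ifP => // _; rewrite ltnS (leq_trans hd).
rewrite (bigD1 mu0) /=; last first.
  by apply/forallP => i; rewrite mu0E; case: eqP => // ->.
rewrite big1 ?addr0 => [|mu /andP[_ ne]].
  congr (_ * x _).
    rewrite /monoX ifT //; apply/eqP/ffunP => i; rewrite ffunE mu0E !ffunE.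
    by case: ifP.
  by apply/ffunP => i; rewrite ffunE mu0E ffunE; case: ifP => // _; rewrite subn0.
apply/eqP; rewrite mulf_eq0; apply/orP; left; apply/eqP; apply: NNPP => h0; have h := monoE _ h0.
by case/eqP: ne; apply/ffunP => i; apply: val_inj; rewrite /= h mu0E.
Qed.

Lemma sone_monoX : @sone k n = monoX 1 0.
Proof.
apply: functional_extensionality => nu; rewrite /sone /monoX; congr (if _ then _ else _).
apply/forallP/eqP => [h|-> i]; last by rewrite !ffunE addn0 if_same.
by apply/ffunP => i; rewrite !ffunE addn0 if_same; apply/eqP.
Qed.

Lemma smul_monoX_monoX c d c' d' :
  smul (monoX c d) (monoX c' d') = monoX (c * c') (d + d').
Proof.
rewrite smul_monoX; apply: functional_extensionality => nu.
rewrite /scale /shift /monoX; case: ifP => hd; last first.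
  by rewrite mulr0; case: eqP => // e; move: hd; rewrite e !ffunE eqxx; lia.
have -> : (mlow d nu == mup d' [ffun=> 0%N]) = (nu == mup (d + d') [ffun=> 0%N]).
  apply/eqP/eqP => /ffunP h; apply/ffunP => i; have := h i; rewrite !ffunE.
    by case: eqP => // ->; move: (nu i0) hd => {h} v; lia.
  by case: eqP => // ->; move: (nu i0) hd => {h} v; lia.
by case: ifP; rewrite ?mulr0.
Qed.

Lemma spow_monoX c d m : spow (monoX c d) m = monoX (c ^+ m) (m * d).
Proof.
elim: m => [|m IH]; first by rewrite mul0n expr0 /spow /= sone_monoX.
by rewrite /spow iterS -/(spow _ _) IH smul_monoX_monoX -exprS mulSn.
Qed.

Lemma shift0 x : shift 0 x = x.
Proof.
apply: functional_extensionality => nu; rewrite /shift leq0n; congr x.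
by apply/ffunP => i; rewrite ffunE subn0 if_same.
Qed.

Lemma scale1 x : scale 1 x = x.
Proof. by apply: functional_extensionality => nu; rewrite /scale mul1r. Qed.

End Shift.

(** * Bounds for the coefficient functionals of a p^-1-linear map *)

Section Automatic.
Variables (k : fieldType) (abs : k -> R) (n p : nat).
Hypothesis absP : is_nonarch_abs abs.
Hypothesis abs_small : forall eps, (0 < eps)%Re -> exists2 r : k, r <> 0 & (abs r < eps)%Re.
Hypothesis p_gt0 : (0 < p)%N.
Variables (phi : series k n -> series k n) (i0 : 'I_n).
Hypothesis phiP : p_inv_linear abs p phi.
Implicit Types (nu : multi n) (x : series k n).

Lemma tate_monoX c d : tate abs (monoX i0 c d).
Proof.
move=> eps eps0; exists d.+1 => nu hnu; rewrite /monoX; case: eqP => [e|_].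
  move: hnu; rewrite e mdeg_mup /mdeg big1 ?add0n ?ltnn // => i _.
  by rewrite ffunE.
by rewrite abs0.
Qed.

Lemma tate_bounded x : tate abs x -> exists B, forall nu, (abs (x nu) <= B)%Re.
Proof.
move=> tx; have [N hN] := tx 1%Re ltac:(lra).
(* Indices of degree below [N] lie in a finite box, and each of their coefficients is bounded by the
   sum [S] over the box; all other coefficients are below 1. *)
pose S := \big[Rplus/0%Re]_(mu : {ffun 'I_n -> 'I_N})
   abs (x [ffun i => nat_of_ord (mu i)]).
have S0 (I : Type) (t : seq I) F : (forall i, (0 <= F i)%Re) ->
    (0 <= \big[Rplus/0%Re]_(i <- t) F i)%Re.
  by move=> F0; elim/big_rec: _ => [|i y _ y0]; have := F0; [lra | move/(_ i); lra].
have Sle (I : eqType) (t : seq I) F i : (forall i, (0 <= F i)%Re) -> i \in t ->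
    (F i <= \big[Rplus/0%Re]_(j <- t) F j)%Re.
  move=> F0; elim: t => // j t IH; rewrite inE big_cons => /orP[/eqP <-|/IH h].
    by have := S0 _ t _ F0; lra.
  by have := F0 j; lra.
have ab i := abs_ge0 absP i.
exists (1 + S)%Re => nu; case: (leqP N (mdeg nu)) => [/hN h|h].
  have : (0 <= S)%Re by apply: S0.
  by lra.
have lt i : (nu i < N)%N.
  by apply: leq_ltn_trans h; rewrite (mdegD1 i) leq_addr.
pose mu : {ffun 'I_n -> 'I_N} := [ffun i => Ordinal (lt i)].
have -> : nu = [ffun i => nat_of_ord (mu i)] by apply/ffunP => i; rewrite !ffunE.
have := Sle _ _ (fun mu : {ffun 'I_n -> 'I_N} => abs (x [ffun i => nat_of_ord (mu i)]))
  mu (fun _ => ab _) (mem_index_enum mu).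
by rewrite -/S; lra.
Qed.

Lemma tate_scale a x : tate abs x -> tate abs (scale a x).
Proof.
move=> tx eps eps0; have a0 := abs_ge0 absP a.
have [|N hN] := tx (eps / (1 + abs a))%Re; first by apply: Rdiv_lt_0_compat; lra.
exists N => nu /hN h; rewrite absM //; set X := abs (x nu) in h *.
have X0 : (0 <= X)%Re by apply: abs_ge0.
have e : eps = (eps / (1 + abs a) * (1 + abs a))%Re by field; lra.
by rewrite e; apply: Rle_lt_trans (_ : X * (1 + abs a) < _)%Re; nra.
Qed.

Lemma tate_shift d x : tate abs x -> tate abs (shift i0 d x).
Proof.
move=> tx eps eps0; have [N hN] := tx eps eps0; exists (N + d)%N => nu hnu.
rewrite /shift; case: ifP => [h|_]; last by rewrite abs0.
by apply: hN; have := mdeg_mlow h; lia.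
Qed.

(** This is linearity for the scalar [r = X^d], whose p-th power is the monomial of exponent
    [p * d]. *)
Lemma phi_shift d x : tate abs x -> phi (shift i0 (p * d) x) = shift i0 d (phi x).
Proof.
case: phiP => _ [_ hM] tx.
have := hM _ _ (@tate_monoX 1 d) tx.
by rewrite spow_monoX expr1n !smul_monoX !scale1.
Qed.

Lemma phi_scale r x : tate abs x -> phi (scale (r ^+ p) x) = scale r (phi x).
Proof.
case: phiP => _ [_ hM] tx.
have := hM _ _ (@tate_monoX r 0) tx.
by rewrite spow_monoX muln0 !smul_monoX !shift0.
Qed.

Variables (x0 : series k n) (nu0 : multi n).
Hypothesis x0P : tate abs x0.

Let f a := phi (scale a x0) nu0.

(** The least shift in direction [i0] whose result has zero coefficient at [nu0] for every
    series. *)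
Let s := (nu0 i0).+1.

(* [lacunary fuel a m] is the sum over [j < fuel] of [a_(m+j) X^(p s j) x0]; at [nu] only the
   terms with [p s j <= nu i0] are nonzero, so any fuel exceeding [nu i0] gives the full series. *)
Fixpoint lacunary (fuel : nat) (a : nat -> k) (m : nat) (nu : multi n) : k :=
  if fuel is fuel'.+1 then
    a m * x0 nu + (if (p * s <= nu i0)%N then lacunary fuel' a m.+1 (mlow i0 (p * s) nu) else 0)
  else 0.

Definition lacunary_series a m : series k n := fun nu => lacunary (nu i0).+1 a m nu.

Lemma ps_gt0 : (0 < p * s)%N.
Proof. by rewrite muln_gt0 p_gt0. Qed.

Lemma lacunary_fuel a m nu fuel1 fuel2 : (nu i0 < fuel1)%N -> (nu i0 < fuel2)%N ->
  lacunary fuel1 a m nu = lacunary fuel2 a m nu.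
Proof.
elim: fuel1 fuel2 m nu => [|f1 IH] [|f2] m nu //= h1 h2; congr (_ + _).
case: ifP => // h; have := ps_gt0 => h0.
by apply: IH; rewrite ffunE eqxx; lia.
Qed.

Lemma lacunaryE a m :
  lacunary_series a m = sadd (scale (a m) x0) (shift i0 (p * s) (lacunary_series a m.+1)).
Proof.
apply: functional_extensionality => nu; rewrite /sadd /scale /shift {1}/lacunary_series [LHS]/=.
congr (_ + _); case: ifP => // h; have := ps_gt0 => h0.
by apply: lacunary_fuel; rewrite ffunE eqxx; lia.
Qed.

Lemma tate_lacunary a m : (forall j, (abs (a j) <= / INR j.+1)%Re) ->
  tate abs (lacunary_series a m).
Proof.
move=> ha eps eps0.
have [B hB] := tate_bounded x0P; have [N0 hN0] := x0P eps0.
have B0 : (0 <= B)%Re by apply: Rle_trans (hB nu0); apply: abs_ge0.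
have [J hJ] : exists J : nat, forall j, (J <= j)%N -> (/ INR j.+1 * B < eps)%Re.
  have [J hJ] := INR_unbounded (B / eps); exists J => j hj.
  have hj' : (INR J < INR j.+1)%Re by apply: lt_INR; lia.
  have ip : (0 < INR j.+1)%Re by apply: lt_0_INR; lia.
  apply: (Rmult_lt_reg_l (INR j.+1)) => //.
  rewrite -Rmult_assoc Rinv_r; last by lra.
  have e : B = (B / eps * eps)%Re by field; lra.
  by rewrite Rmult_1_l e; apply: Rmult_lt_compat_r; lra.
exists (N0 + (J - m) * (p * s))%N => nu hnu.
rewrite /lacunary_series; move: (nu i0).+1 => fuel.
(* The threshold drops by [p * s] whenever [m] grows by 1, matching the degree lost by [mlow]. Terms
   with [m < J] are small because [x0] is evaluated in degree at least [N0]; terms with [J <= m] are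
   small because [a m] is. *)
have {hnu} : (m < J -> N0 + (J - m) * (p * s) <= mdeg nu)%N by [].
elim: fuel m nu => [|fuel IH] m nu hnu /=; first by rewrite abs0.
apply: absD_lt => //.
  rewrite absM //; have am := ha m; have a0 := abs_ge0 absP (a m).
  have x0' := abs_ge0 absP (x0 nu).
  case: (leqP J m) => hm.
    by have h1 := hJ _ hm; have h2 := hB nu; nra.
  have h1 : (abs (x0 nu) < eps)%Re by apply: hN0; apply: leq_trans (hnu hm); apply: leq_addr.
  have h2 : (/ INR m.+1 <= 1)%Re.
    rewrite -Rinv_1; apply: Rinv_le_contravar; first by lra.
    by have := le_INR 1 m.+1 ltac:(lia).
  by nra.
case: ifP => [h|_]; last by rewrite abs0.
apply: IH => hm; have := mdeg_mlow h; have := hnu ltac:(lia).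
have -> : (J - m = (J - m.+1).+1)%N by lia.
by rewrite mulSn; lia.
Qed.

(* Gliding hump: if [f] were unbounded, choose [a_j] small with [f a_j] dominating every
   coefficient of [phi (a_i x0)], [i < j]; then [phi] of the lacunary series has
   coefficients of absolute value [abs (f a_j) > 1] in arbitrarily high degrees. *)
Lemma functional_bounded : exists C, forall a, (abs a <= 1)%Re -> (abs (f a) <= C)%Re.
Proof.
case: (phiP) => phiT [phiD _].
apply: NNPP => unb.
(* Unboundedness on the unit ball passes to arbitrarily small balls: [f (r ^+ p * a) = r * f a],
   while [r ^+ p * a] has norm at most that of [r]. *)
have pick (m : nat) (b : R) : exists a, (abs a <= / INR m.+1)%Re /\ (b < abs (f a))%Re.
  have e0 : (0 < Rmin 1 (/ INR m.+1))%Re.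
    by apply: Rmin_pos; [lra|apply: Rinv_0_lt_compat; apply: lt_0_INR; lia].
  have [r r0 hr] := abs_small e0.
  have ar := abs_gt0 absP r0.
  have r1 := Rmin_l 1 (/ INR m.+1); have r2 := Rmin_r 1 (/ INR m.+1).
  have [a [a1 fa]] : exists a, (abs a <= 1)%Re /\ (b / abs r < abs (f a))%Re.
    apply: NNPP => h; apply: unb; exists (b / abs r)%Re => a ha.
    by apply: Rnot_lt_le => h2; apply: h; exists a.
  exists (r ^+ p * a); split.
    rewrite absM // absX //; case: (p) p_gt0 => // q _; rewrite -tech_pow_Rmult.
    have rq : (0 <= abs r ^ q <= 1)%Re.
      by elim: q => [|q IH] /=; [lra | nra].
    have a0 := abs_ge0 absP a.
    have : (abs r ^ q * abs a <= 1)%Re by nra.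
    move=> ra; apply: Rle_trans (_ : _ <= abs r * 1)%Re _; last by lra.
    by rewrite Rmult_assoc; apply: Rmult_le_compat_l; lra.
  have -> : f (r ^+ p * a) = r * f a.
    rewrite /f -[RHS]/(scale r (phi (scale a x0)) nu0) -phi_scale; last exact: tate_scale.
    by congr (phi _ nu0); apply: functional_extensionality => nu; rewrite /scale mulrA.
  rewrite absM //.
  have -> : b = (abs r * (b / abs r))%Re by field; lra.
  exact: Rmult_lt_compat_l.
have bnd a : exists B, forall nu, (abs (phi (scale a x0) nu) <= B)%Re.
  by apply: tate_bounded; apply: phiT; apply: tate_scale.
pose P m b := sval (cid (pick m b)).
pose B a := sval (cid (bnd a)).
have PP m b : (abs (P m b) <= / INR m.+1)%Re /\ (b < abs (f (P m b)))%Re.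
  by rewrite /P; case: cid.
have BP a nu : (abs (phi (scale a x0) nu) <= B a)%Re.
  by rewrite /B; case: cid.
(* [bb m] is the maximum of 1 and of the coefficient bounds [B (a i)] for [i < m]; [a m] is then
   chosen with [f (a m)] beyond [bb m]. *)
pose bb := fix bb (m : nat) : R := if m is m'.+1 then Rmax (bb m') (B (P m' (bb m'))) else 1%Re.
pose a m := P m (bb m).
have bbS m : bb m.+1 = Rmax (bb m) (B (a m)) by [].
have bb_le i j : (bb i <= bb (i + j)%N)%Re.
  elim: j => [|j IH]; first by rewrite addn0; lra.
  by rewrite addnS bbS; apply: Rle_trans IH _; apply: Rmax_l.
have Ba i j : (B (a i) <= bb (i.+1 + j)%N)%Re.
  by apply: Rle_trans (bb_le _ _); rewrite bbS; apply: Rmax_r.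
have a_small j : (abs (a j) <= / INR j.+1)%Re by case: (PP j (bb j)).
have fa j : (bb j < abs (f (a j)))%Re by case: (PP j (bb j)).
pose h m := phi (lacunary_series a m).
have tl m := @tate_lacunary a m a_small.
have hE m nu : h m nu = phi (scale (a m) x0) nu + shift i0 s (h m.+1) nu.
  rewrite /h {1}lacunaryE phiD; first by rewrite phi_shift.
    exact: tate_scale.
  exact: tate_shift.
(* By [hE], [h m] is the image of [a m * x0] plus the shift by [s] of [h m.+1]. At [nu0] the shifted
   part vanishes by the choice of [s]; further out, the tail strictly dominates the first
   summand. *)
have key j m : abs (h m (mup i0 (j * s) nu0)) = abs (f (a (m + j)%N)).
  elim: j m => [|j IH] m.
    rewrite mul0n addn0 hE /shift ffunE eqxx addn0 ltnn addr0.
    by congr (abs (phi _ _)); apply/ffunP => i; rewrite ffunE addn0 if_same.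
  rewrite hE /shift ifT; last by rewrite ffunE eqxx mulSn; lia.
  have -> : mlow i0 s (mup i0 (j.+1 * s) nu0) = mup i0 (j * s) nu0.
    by apply/ffunP => i; rewrite !ffunE mulSn; case: eqP => // _; lia.
  rewrite addnS -addSn -IH; apply: absD_dominant => //.
  rewrite IH; apply: Rle_lt_trans (fa _).
  exact: Rle_trans (BP _ _) (Ba _ _).
have [N hN] := phiT _ (tl 0%N) 1%Re ltac:(lra).
have := hN (mup i0 (N * s) nu0); rewrite mdeg_mup => /(_ ltac:(nia)).
rewrite -/(h 0%N) key add0n; have := fa N; have := bb_le 0%N N; rewrite add0n /=.
by lra.
Qed.

End Automatic.

(** * The subfield where the derivations tend to zero *)

Section VanishingDerivations.
Variables (p : nat) (L : fieldType) (N : L -> R) (D : nat -> L -> L) (X : nat -> L).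
Hypothesis pcharL : p \in [pchar L].
Hypothesis NP : is_nonarch_abs N.
Hypothesis DD : forall j, {morph D j : x y / x + y}.
Hypothesis DM : forall j x y, D j (x * y) = D j x * y + x * D j y.
Hypothesis DN : forall j x, (N (D j x) <= N x)%Re.
Hypothesis NX : forall j, (N (X j) <= 1)%Re.
Hypothesis DX : forall i j, D i (X j) = (i == j)%:R.
Hypothesis N_surj : forall rho, (0 < rho)%Re -> exists t, N t = rho.
Hypothesis N_spherical : forall (e : nat -> L) (r : nat -> R),
  (forall i j, (i <= j)%N -> (N (e j - e i) <= r i)%Re) ->
  exists w, forall i, (N (w - e i) <= r i)%Re.

Definition vanishing (a : nat -> L) :=
  forall eps, (0 < eps)%Re -> exists J : nat, forall j, (J <= j)%N -> (N (a j) < eps)%Re.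

Lemma vanishingD a b : vanishing a -> vanishing b -> vanishing (fun j => a j + b j).
Proof.
move=> ha hb eps e0; have [J hJ] := ha _ e0; have [J' hJ'] := hb _ e0.
by exists (J + J')%N => j hj; apply: absD_lt => //; [apply: hJ|apply: hJ']; lia.
Qed.

Lemma vanishingM c a : vanishing a -> vanishing (fun j => c * a j).
Proof.
move=> ha eps e0; have c0 := abs_ge0 NP c.
have [|J hJ] := ha (eps / (1 + N c))%Re; first by apply: Rdiv_lt_0_compat; lra.
exists J => j /hJ h; rewrite absM //; have a0 := abs_ge0 NP (a j).
have e : eps = (eps / (1 + N c) * (1 + N c))%Re by field; lra.
by rewrite e; apply: Rle_lt_trans (_ : N (a j) * (1 + N c) < _)%Re; nra.
Qed.

Lemma der0 j : D j 0 = 0.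
Proof. by apply: (addrI (D j 0)); rewrite -DD !addr0. Qed.

Lemma derB j x y : D j (x - y) = D j x - D j y.
Proof. by apply: (addIr (D j y)); rewrite -DD !subrK. Qed.

Lemma der1 j : D j 1 = 0.
Proof. by apply: (addrI (D j 1)); rewrite addr0 -[RHS](congr1 (D j) (mulr1 1)) DM mulr1 mul1r. Qed.

Lemma der_exp_pchar j x : D j (x ^+ p) = 0.
Proof.
have h m : D j (x ^+ m) = (x ^+ m.-1 * D j x) *+ m.
  elim: m => [|m IH]; first by rewrite expr0 der1 mulr0n.
  rewrite exprS DM IH [in RHS]mulrS mulrC; congr (_ + _).
  by rewrite mulrnAr mulrA; case: (m) => [|m']; rewrite ?mulr0n // -exprS.
by rewrite h -mulr_natl (pcharf0 pcharL) mul0r.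
Qed.

(** The quotient rule, written as a combination of [D j x] and [D j y] with coefficients independent
    of [j], so that convergence to zero is inherited. *)
Lemma der_div j x y : y != 0 -> D j (x / y) = y^-1 * D j x - (y^-1 * (x / y)) * D j y.
Proof.
move=> y0; have -> : D j x = D j (x / y) * y + x / y * D j y by rewrite -DM divfK.
by rewrite mulrDr [_^-1 * (_ * y)]mulrCA mulVf // mulr1 [_^-1 * (_ * D j y)]mulrA addrK.
Qed.

(** * The valued field [kfield]: constants, norms and completeness *)

Definition van : {pred L} := fun u => `[< vanishing (fun j => D j u) >].

Lemma vanP u : reflect (vanishing (fun j => D j u)) (u \in van).
Proof. exact: asboolP. Qed.

Lemma vanishing0 : vanishing (fun => 0).
Proof. by move=> eps e0; exists 0%N => j _; rewrite abs0. Qed.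

Lemma vanishing_ext a b : a =1 b -> vanishing a -> vanishing b.
Proof. by move=> /functional_extensionality ->. Qed.

Lemma van_divring_closed : divring_closed van.
Proof.
split=> [|x y /vanP hx /vanP hy|x y /vanP hx /vanP hy]; apply/vanP.
- by apply: vanishing_ext vanishing0 => j; rewrite der1.
- apply: vanishing_ext (vanishingD hx (vanishingM (-1) hy)) => j.
  by rewrite derB mulN1r.
have [->|y0] := eqVneq y 0.
  by apply: vanishing_ext vanishing0 => j; rewrite invr0 mulr0 der0.
have h := vanishingD (vanishingM y^-1 hx) (vanishingM (- (y^-1 * (x / y))) hy).
by apply: vanishing_ext h => j; rewrite der_div // mulNr.
Qed.

HB.instance Definition _ := GRing.isDivringClosed.Build L van van_divring_closed.

Record kfield := KField { kval : L; _ : kval \in van }.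
HB.instance Definition _ := [isSub for kval].
HB.instance Definition _ := [Choice of kfield by <:].
HB.instance Definition _ := [SubChoice_isSubUnitRing of kfield by <:].
HB.instance Definition _ := [SubNzRing_isSubComNzRing of kfield by <:].
HB.instance Definition _ := [SubComUnitRing_isSubIntegralDomain of kfield by <:].
HB.instance Definition _ := [SubIntegralDomain_isSubField of kfield by <:].

HB.instance Definition _ := GRing.RMorphism.copy kval (val : kfield -> L).
Bind Scope ring_scope with kfield.
Definition kabs (u : kfield) : R := N (kval u).

Lemma kabsP : is_nonarch_abs kabs.
Proof.
split=> [x|]; first exact: (abs_ge0 NP (kval x)).
split=> [x|]; first split=> [/(abs_eq0 NP) x0|->]; first exact: val_inj.
  exact: (abs0 NP).
by split=> x y; [exact: (absD NP (kval x) (kval y)) | exact: (absM NP (kval x) (kval y))].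
Qed.

Lemma kpchar : p \in [pchar kfield].
Proof.
have := pcharL; rewrite !inE => /andP[-> /eqP h] /=; apply/eqP/val_inj.
by rewrite rmorph_nat h rmorph0.
Qed.

Lemma van_pow y : y ^+ p \in van.
Proof. by apply/vanP; apply: vanishing_ext vanishing0 => j; rewrite der_exp_pchar. Qed.

Definition kpow y : kfield := KField (van_pow y).

Lemma pchar_gt0 : (0 < p)%N.
Proof. by apply: prime_gt0; case/andP: pcharL. Qed.

(** The element [t] is the p-th power of an element of [L] of norm [rho] to the power [1 / p]; p-th
    powers are killed by all derivations. *)
Lemma kabs_surj rho : (0 < rho)%Re ->
  exists t : kfield, kabs t = rho /\ forall j, D j (kval t) = 0.
Proof.
move=> rho0; have [y hy] := N_surj (exp_pos (ln rho / INR p)).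
exists (kpow y); split=> [|j]; last exact: der_exp_pchar.
rewrite /kabs /= absX // hy -Rpower_pow; last exact: exp_pos.
rewrite /Rpower ln_exp.
have -> : (INR p * (ln rho / INR p) = ln rho)%Re; last exact: exp_ln.
by field; apply: not_0_INR; have := pchar_gt0; lia.
Qed.

Lemma kabs_nontrivial : abs_nontrivial kabs.
Proof.
have [|t [ht _]] := @kabs_surj 2; first by lra.
exists t; rewrite ht; split; last by lra.
by move=> t0; move: ht; rewrite t0 (abs0 kabsP); lra.
Qed.

Lemma kabs_small eps : (0 < eps)%Re -> exists2 r : kfield, r <> 0 & (kabs r < eps)%Re.
Proof.
move=> e0; have [|t [ht _]] := @kabs_surj (eps / 2); first by lra.
exists t; last by lra.
by move=> t0; move: ht; rewrite t0 (abs0 kabsP); lra.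
Qed.

Lemma inv_INR_small eps : (0 < eps)%Re -> exists i : nat, (/ INR i.+1 < eps)%Re.
Proof.
move=> e0; have [i [hi i0]] := archimed_cor1 _ e0; exists i.
apply: Rle_lt_trans hi; apply: Rinv_le_contravar; first by apply: lt_0_INR.
by apply: le_INR; lia.
Qed.

Lemma kabs_complete : abs_complete kabs.
Proof.
move=> u cauchy.
have c i := cauchy (/ INR i.+1)%Re ltac:(apply: Rinv_0_lt_compat; apply: lt_0_INR; lia).
pose M i := sval (cid (c i)).
have MP i m n : (M i <= m)%N -> (M i <= n)%N -> (kabs (u m - u n) < / INR i.+1)%Re.
  by rewrite /M; case: cid => /= ? h; apply: h.
(* The sum exceeds every [M j] with [j <= i], so the terms [u (S i)] are centres of nested balls of
   radii [/ INR i.+1], and spherical completeness of [L] supplies a limit [w]. *)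
pose S i := (\sum_(j < i.+1) M j)%N.
have MS i j : (i <= j)%N -> (M i <= S j)%N.
  move=> ij; have lt : (i < j.+1)%N by [].
  by rewrite /S (bigD1 (Ordinal lt)) //= leq_addr.
have [i j ij|w hw] := @N_spherical (fun i => kval (u (S i))) (fun i => / INR i.+1)%Re.
  by apply: Rlt_le; apply: MP; apply: MS.
have near eps : (0 < eps)%Re -> exists K : nat,
    forall m, (K <= m)%N -> (N (w - kval (u m)) < eps)%Re.
  move=> e0; have [i hi] := inv_INR_small e0; exists (S i) => m hm.
  have -> : w - kval (u m) = (w - kval (u (S i))) + (kval (u (S i) - u m)).
    by rewrite rmorphB addrA subrK.
  apply: absD_lt => //; first by apply: Rle_lt_trans (hw i) hi.
  by apply: Rlt_trans hi; apply: MP; [apply: MS | apply: leq_trans hm; apply: MS].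
(* The subfield is closed: [D j w] differs from [D j (kval (u K))] by at most the norm of
   [w - kval (u K)], uniformly in [j]. *)
have wv : w \in van.
  apply/vanP => eps e0; have [K hK] := near eps e0.
  have /vanP uv := valP (u K); have [J hJ] := uv eps e0; exists J => j hj.
  rewrite -[D j w](subrK (D j (kval (u K)))) -derB; apply: absD_lt => //; last exact: hJ.
  by apply: Rle_lt_trans (DN _ _) _; apply: hK.
exists (KField wv) => eps /near[K hK]; exists K => m hm.
by rewrite absB_sym; [apply: hK | apply: kabsP].
Qed.

(** * Bounded linear functionals from [L] to [kfield] *)

Section NoFunctional.
Variable F : L -> kfield.
Hypothesis FD : {morph F : x y / x + y}.
Hypothesis FZ : forall (c : kfield) y, F (kval c * y) = c * F y.
Variable C : R.
Hypothesis FC : forall y, (N y <= 1)%Re -> (kabs (F y) <= C)%Re.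

Lemma functionalB x y : F (x - y) = F x - F y.
Proof. by apply: (addIr (F y)); rewrite -FD !subrK. Qed.

(* The witness for the absence of nonzero functionals is a pseudo-limit [w] of the sums of
   [X_i t_i e_i], where [F e_i = 1] and [N e_i] approaches the reciprocal of the norm of [F]
   while [N t_i] decreases to [1].  Then [D_m (F w)] is dominated by [t_m] for every [m],
   so [F w] cannot belong to [kfield]. *)
Lemma bounded_functional_eq0 y : F y = 0.
Proof.
apply: NNPP => Fy.
have F0 : F 0 = 0 by rewrite -(subrr 0) functionalB subrr.
have y0 : y <> 0 by move=> y0; apply: Fy; rewrite y0.
have normalize z : z <> 0 -> exists c : kfield, kabs c = (/ N z)%Re /\ N (kval c * z) = 1%Re.
  move=> z0; have nz := abs_gt0 NP z0.
  have [c [hc _]] := @kabs_surj (/ N z) (Rinv_0_lt_compat _ nz).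
  by exists c; split=> //; rewrite absM // -/(kabs c) hc Rinv_l //; lra.
(* The supremum [s] of [E] is the operator norm of [F]. Since [kfield] has elements of every
   positive norm, vectors can be scaled to norm exactly 1, which gives [Fle]. *)
pose E r := exists2 z, (N z <= 1)%Re & r = kabs (F z).
have [s [s_ub s_lub]] : {s | is_lub E s}.
  apply: completeness; first by exists C => r [z z1 ->]; apply: FC.
  by exists (kabs (F 0)), 0 => //; rewrite abs0 //; lra.
have Fle z : (kabs (F z) <= s * N z)%Re.
  have [->|/eqP z0] := eqVneq z 0.
    by rewrite F0 (abs0 kabsP) abs0 //; lra.
  have [c [hc hz]] := normalize z z0.
  have : (kabs (F (kval c * z)) <= s)%Re.
    by apply: s_ub; exists (kval c * z) => //; lra.
  rewrite FZ (absM kabsP) hc => h; have nz := abs_gt0 NP z0.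
  have -> : kabs (F z) = (/ N z * kabs (F z) * N z)%Re by field; lra.
  by apply: Rmult_le_compat_r; lra.
have s0 : (0 < s)%Re.
  have h := Fle y; have h1 := abs_gt0 kabsP Fy; have h2 := abs_gt0 NP y0.
  by nra.
(* The two sequences interlace, [sigma i.+1 < rho i < sigma i], and decrease to 1: [rho] gives the
   norms of the [t i], and [sigma] leaves room for the norm of [F] not being attained. *)
pose rho (i : nat) := (1 + / (INR i + 1))%Re.
pose sigma (i : nat) := (1 + / (INR i + / 2))%Re.
have pi (i : nat) : (0 <= INR i)%Re by apply: pos_INR.
have rho1 i : (1 < rho i)%Re.
  by have := Rinv_0_lt_compat (INR i + 1) ltac:(have := pi i; lra); rewrite /rho; lra.
have rho_sigma i : (rho i < sigma i)%Re.
  by have := pi i => ?; apply: Rplus_lt_compat_l; apply: Rinv_lt_contravar; nra.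
have sigma_rho i : (sigma i.+1 < rho i)%Re.
  by have := pi i => ?; rewrite /sigma S_INR;
    apply: Rplus_lt_compat_l; apply: Rinv_lt_contravar; nra.
(* Take [z] in the unit ball on which [F] exceeds the fraction [rho i / sigma i] of its norm, and
   divide [z] by the scalar [F z]. *)
have e_ex i : exists e, F e = 1 /\ (N e * rho i <= sigma i / s)%Re.
  have r1 := rho1 i; have rs := rho_sigma i.
  have q0 : (0 < rho i / sigma i)%Re by apply: Rdiv_lt_0_compat; lra.
  have q1 : (rho i / sigma i < 1)%Re.
    by apply: (Rmult_lt_reg_r (sigma i)); rewrite /Rdiv ?Rmult_assoc ?Rinv_l; lra.
  have [z [z1 hz]] : exists z, (N z <= 1)%Re /\ (s * (rho i / sigma i) < kabs (F z))%Re.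
    apply: NNPP => h; have : (s <= s * (rho i / sigma i))%Re; last by nra.
    apply: s_lub => r [z z1 ->]; apply: Rnot_lt_le => h2.
    by apply: h; exists z.
  have fz : (0 < kabs (F z))%Re by nra.
  have fz0 : F z <> 0 by move=> h; rewrite h (abs0 kabsP) in fz; lra.
  exists (kval (F z)^-1 * z); split; first by rewrite FZ mulVf //; apply/eqP.
  rewrite absM // -/(kabs _) (absV kabsP fz0).
  have h : (/ kabs (F z) <= sigma i / (s * rho i))%Re.
    have -> : (sigma i / (s * rho i) = / (s * (rho i / sigma i)))%Re by field; lra.
    by apply: Rinv_le_contravar; nra.
  have -> : (sigma i / s = sigma i / (s * rho i) * rho i)%Re by field; lra.
  apply: Rmult_le_compat_r; first by lra.
  have := Rinv_0_lt_compat _ fz; have := abs_ge0 NP z; nra.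
pose e i := sval (cid (e_ex i)).
have eP i : F (e i) = 1 /\ (N (e i) * rho i <= sigma i / s)%Re.
  by rewrite /e; case: cid.
have t_ex i := @kabs_surj (rho i) ltac:(have := rho1 i; lra).
pose t i := sval (cid (t_ex i)).
have tP i : kabs (t i) = rho i /\ forall j, D j (kval (t i)) = 0.
  by rewrite /t; case: cid.
have Xv i : X i \in van.
  apply/vanP => eps e0; exists i.+1 => j hj; rewrite DX.
  by case: eqP => [h|_]; [lia | rewrite abs0].
pose Xk i := KField (Xv i).
pose P m := \sum_(i < m) kval (Xk i * t i) * e i.
have PS m : P m.+1 = P m + kval (Xk m * t m) * e m by rewrite /P big_ord_recr.
have sigmaS i : (sigma i.+1 < sigma i)%Re by apply: Rlt_trans (sigma_rho i) (rho_sigma i).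
have PN i d : (N (P (i + d)%N - P i) <= sigma i / s)%Re.
  elim: d i => [|d IH] i.
    rewrite addn0 subrr abs0 //; apply: Rlt_le; apply: Rdiv_lt_0_compat => //.
    by have := rho1 i; have := rho_sigma i; lra.
  have -> : P (i + d.+1)%N - P i = (P (i.+1 + d)%N - P i.+1) + kval (Xk i * t i) * e i.
    by rewrite addnS -addSn PS opprD addrA subrK.
  apply: absD_le => //.
    apply: Rle_trans (IH _) _; apply: Rmult_le_compat_r; last by have := sigmaS i; lra.
    by apply: Rlt_le; apply: Rinv_0_lt_compat.
  rewrite absM // rmorphM absM //; have [_ he] := eP i; have [ht _] := tP i.
  apply: Rle_trans he; rewrite -/(kabs (t i)) ht /=.
  have := NX i; have := abs_ge0 NP (X i); have := abs_ge0 NP (e i); have := rho1 i.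
  set a := rho i; set b := N (e i); set c := N (X i) => a1 b0 c0 c1.
  have : (0 <= a * b)%Re by nra.
  move=> ab; have : (c * (a * b) <= 1 * (a * b))%Re by apply: Rmult_le_compat_r.
  by rewrite -Rmult_assoc; lra.
have [i j ij|w hw] := @N_spherical P (fun i => sigma i / s)%Re.
  by rewrite -(subnKC ij); apply: PN.
have FP m : F (P m) = \sum_(i < m) Xk i * t i.
  elim: m => [|m IH]; first by rewrite /P !big_ord0 F0.
  rewrite PS FD IH [RHS]big_ord_recr; congr (_ + _).
  by rewrite FZ; case: (eP m) => -> _; rewrite mulr1.
(* The [t i] are constants and [D m (X i) = 0] for [i < m], so only the last summand contributes. *)
have DP m : D m (kval (F (P m.+1))) = kval (t m).
  rewrite FP rmorph_sum big_ord_recr /= DD DM DX eqxx mul1r.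
  case: (tP m) => _ ->; rewrite mulr0 addr0.
  suff -> : D m (\sum_(i < m) X i * kval (t i)) = 0 by rewrite add0r.
  have : forall q, (q <= m)%N -> D m (\sum_(i < q) X i * kval (t i)) = 0.
    elim=> [|q IH] hq; first by rewrite big_ord0 der0.
    rewrite big_ord_recr /= DD IH ?(ltnW hq) // add0r DM DX.
    by case: (tP q) => _ ->; rewrite mulr0 addr0 gtn_eqF // mul0r.
  exact.
(* [F w] lies within [s * (sigma m.+1 / s) = sigma m.+1 < rho m] of [F (P m.+1)], and [D m] is
   contractive, so the norm [rho m] of [t m] prevails. *)
have big m : N (D m (kval (F w))) = rho m.
  have tm : N (kval (t m)) = rho m by case: (tP m).
  rewrite -tm -(DP m) -{1}(subrK (kval (F (P m.+1))) (kval (F w))) DD.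
  apply: absD_dominant => //; rewrite DP tm.
  apply: Rle_lt_trans (DN _ _) _; apply: Rle_lt_trans (sigma_rho m).
  rewrite -rmorphB -functionalB; apply: Rle_trans (Fle _) _.
  have -> : sigma m.+1 = (s * (sigma m.+1 / s))%Re by field; lra.
  by apply: Rmult_le_compat_l; [lra | apply: hw].
have /vanP/(_ 1%Re ltac:(lra)) [J hJ] := valP (F w).
by have := hJ J (leqnn J); rewrite big; have := rho1 J; lra.
Qed.
End NoFunctional.

(** * The Tate algebras over [kfield] *)

Lemma no_p_inv_linear n (phi : series kfield n -> series kfield n) : (0 < n)%N ->
  p_inv_linear kabs p phi -> forall x, tate kabs x -> phi x = @szero kfield n.
Proof.
move=> n0 phiP x tx; apply: functional_extensionality => nu0.
pose i0 := Ordinal n0.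
have [C fC] := functional_bounded kabsP kabs_small pchar_gt0 i0 phiP nu0 tx.
have ts a : tate kabs (scale a x) := tate_scale kabsP a tx.
(* The Frobenius maps [L] into [kfield]. Composing with it makes the coefficient functional linear
   over [kfield], because [phi] takes p-th roots of scalars; the value [F 1] is the coefficient of
   [phi x] at [nu0]. *)
pose F y := phi (scale (kpow y) x) nu0.
have FD : {morph F : y z / y + z}.
  move=> y z; rewrite /F; case: (phiP) => _ [phiD _].
  rewrite -[RHS]/(sadd (phi (scale (kpow y) x)) (phi (scale (kpow z) x)) nu0) -phiD //.
  congr (phi _ nu0); apply: functional_extensionality => nu; rewrite /sadd /scale -mulrDl.
  congr (_ * _); apply: val_inj; rewrite rmorphD /= exprDn_pchar //.
  by rewrite pnatE; case/andP: (pcharL).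
have FZ (c : kfield) y : F (kval c * y) = c * F y.
  rewrite /F -[RHS]/(scale c (phi (scale (kpow y) x)) nu0) -(phi_scale kabsP i0 phiP) //.
  congr (phi _ nu0); apply: functional_extensionality => nu; rewrite /scale mulrA.
  by congr (_ * _); apply: val_inj; rewrite rmorphM rmorphXn /= exprMn.
have FC y : (N y <= 1)%Re -> (kabs (F y) <= C)%Re.
  move=> y1; apply: fC; rewrite /kabs /= absX //.
  rewrite -(pow1 p); apply: pow_incr; split=> //; exact: abs_ge0.
have := bounded_functional_eq0 FD FZ FC 1; rewrite /F.
have -> : scale (kpow 1) x = x; last by [].
apply: functional_extensionality => nu; rewrite /scale -[RHS]mul1r; congr (_ * _).
by apply: val_inj; rewrite rmorph1 /= expr1n.
Qed.

Lemma exists_valued_field_without_p_inv_linear_map :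
  exists (k : fieldType) (abs : k -> R),
    p \in [pchar k] /\ is_nonarch_abs abs /\ abs_complete abs /\ abs_nontrivial abs /\
    forall n : nat, (0 < n)%N ->
      (forall phi : series k n -> series k n, p_inv_linear abs p phi ->
         forall x : series k n, tate abs x -> phi x = @szero k n) /\
      ~ frobenius_split abs n p.
Proof.
exists kfield, kabs; split; first exact: kpchar.
split; first exact: kabsP.
split; first exact: kabs_complete.
split; first exact: kabs_nontrivial.
move=> n n0; split; first by move=> phi; apply: no_p_inv_linear.
case=> phi [phiP phi1].
have t1 : tate kabs (@sone kfield n).
  by rewrite (sone_monoX _ (Ordinal n0)); apply: tate_monoX; apply: kabsP.
have := no_p_inv_linear n0 phiP t1; rewrite phi1.
move/(congr1 (fun g => g [ffun=> 0%N])); rewrite /sone /szero ifT.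
  by move/eqP; rewrite oner_eq0.
by apply/forallP => i; rewrite ffunE.
Qed.
End VanishingDerivations.

(** * Rational function fields *)

Local Notation "x %:F" := (FracField.tofrac x).

(** * Extension of absolute values and derivations to fraction fields *)

Section FractionAbs.
Variables (A : idomainType) (w : A -> R).
Hypothesis w_ge0 : forall a, (0 <= w a)%Re.
Hypothesis w_eq0 : forall a, w a = 0%Re <-> a = 0.
Hypothesis wD : forall a b, (w (a + b) <= Rmax (w a) (w b))%Re.
Hypothesis wM : forall a b, w (a * b) = (w a * w b)%Re.

Let num (x : {fraction A}) := \n_(repr x).
Let den (x : {fraction A}) := \d_(repr x).

Definition frac_abs x := (w (num x) / w (den x))%Re.

Lemma den_neq0 x : den x != 0.
Proof. exact: denom_ratioP. Qed.

Lemma frac_numden x : x = (num x)%:F / (den x)%:F.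
Proof.
have d0 : (den x)%:F != 0 by rewrite tofrac_eq0 den_neq0.
apply: (mulIf d0); rewrite divfK // /num /den -{1}[x]reprK.
(* Both sides become classes of explicit pairs, where equality is cross multiplication. *)
unlock FracField.tofrac; rewrite -[LHS]FracField.pi_mul.
apply/eqmodP; rewrite /= FracField.equivfE /FracField.mulf.
rewrite !numden_Ratio ?mulf_neq0 ?denom_ratioP ?oner_neq0 //.
by rewrite !mulr1 mulrC.
Qed.

Lemma frac_ex (x : {fraction A}) : exists a b : A, b != 0 /\ x = a%:F / b%:F.
Proof. by exists (num x), (den x); rewrite den_neq0 -frac_numden. Qed.

Lemma frac_div_eq (a b c d : A) : b != 0 -> d != 0 ->
  a%:F / b%:F = c%:F / d%:F -> a * d = c * b.
Proof.
move=> b0 d0 /eqP; rewrite eqr_div ?tofrac_eq0 // -!tofracM tofrac_eq => /eqP.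
by [].
Qed.

Lemma w_gt0 a : a != 0 -> (0 < w a)%Re.
Proof. by move=> a0; case: (w_ge0 a) => // /esym/w_eq0/eqP; rewrite (negPf a0). Qed.

Lemma frac_absE a b : b != 0 -> frac_abs (a%:F / b%:F) = (w a / w b)%Re.
Proof.
move=> b0; rewrite /frac_abs; set x := _ / _.
have := frac_div_eq b0 (den_neq0 x) (frac_numden x).
move/(congr1 w); rewrite !wM => h; have h1 := w_gt0 b0; have h2 := w_gt0 (den_neq0 x).
apply: (Rmult_eq_reg_r (w b * w (den x))); last by nra.
by field_simplify; lra.
Qed.

Lemma w1 : w 1 = 1%Re.
Proof.
have := wM 1 1; rewrite mulr1 => e; have h : (0 < w 1)%Re by apply: w_gt0; apply: oner_neq0.
by apply: (Rmult_eq_reg_l (w 1)); lra.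
Qed.

Lemma frac_abs_tofrac a : frac_abs a%:F = w a.
Proof. by rewrite -[a%:F]divr1 -tofrac1 frac_absE ?oner_neq0 // w1 Rdiv_1_r. Qed.

Lemma frac_absP : is_nonarch_abs frac_abs.
Proof.
split=> [x|].
  have h1 := w_ge0 (num x); have h2 := w_gt0 (den_neq0 x).
  by apply: Rmult_le_pos => //; apply: Rlt_le; apply: Rinv_0_lt_compat.
split=> [x|].
  split=> [|->]; last by rewrite -tofrac0 frac_abs_tofrac; apply/w_eq0.
  have h2 := Rinv_0_lt_compat _ (w_gt0 (den_neq0 x)).
  move/Rmult_integral; case => [/w_eq0 h|h]; last by move: h2; rewrite h; lra.
  by rewrite (frac_numden x) h tofrac0 mul0r.
split=> x y; have [a [b [b0 ->]]] := frac_ex x; have [c [d [d0 ->]]] := frac_ex y.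
  rewrite addf_div ?tofrac_eq0 // -!tofracM -tofracD !frac_absE ?mulf_neq0 //.
  have h1 := w_gt0 b0; have h2 := w_gt0 d0.
  have i1 := Rinv_0_lt_compat _ h1; have i2 := Rinv_0_lt_compat _ h2.
  have -> : (w a / w b = w (a * d) / w (b * d))%Re by rewrite !wM; field; lra.
  have -> : (w c / w d = w (c * b) / w (b * d))%Re by rewrite !wM; field; lra.
  have i : (0 <= / w (b * d))%Re by rewrite wM Rinv_mult; nra.
  have := wD (a * d) (c * b); rewrite /Rdiv => l.
  apply: Rle_trans (Rmult_le_compat_r _ _ _ i l) _.
  have [h|h] := Rle_or_lt (w (a * d)) (w (c * b)).
    by rewrite Rmax_right //; apply: Rmax_r.
  by rewrite Rmax_left; [apply: Rmax_l | lra].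
rewrite mulf_div -!tofracM !frac_absE ?mulf_neq0 // !wM.
by have h1 := w_gt0 b0; have h2 := w_gt0 d0; field; lra.
Qed.

Import mathcomp.algebra_tactics.ring.
Variable d : A -> A.
Hypothesis dD : {morph d : a b / a + b}.
Hypothesis dM : forall a b, d (a * b) = d a * b + a * d b.
Hypothesis d_le : forall a, (w (d a) <= w a)%Re.

(** The quotient rule on the representative chosen by [repr]; [frac_derE] shows that any other
    fraction gives the same value. *)
Definition frac_der x : {fraction A} :=
  (d (num x) * den x - num x * d (den x))%:F / (den x * den x)%:F.

Lemma frac_derE a b : b != 0 ->
  frac_der (a%:F / b%:F) = (d a * b - a * d b)%:F / (b * b)%:F.
Proof.
move=> b0; rewrite /frac_der; set x := a%:F / b%:F.
have := frac_div_eq b0 (den_neq0 x) (frac_numden x).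
move: (num x) (den x) (den_neq0 x) => n m m0 e.
apply/eqP; rewrite eqr_div ?tofrac_eq0 ?mulf_neq0 // -!tofracM tofrac_eq; apply/eqP.
(* Differentiating [a * m = n * b] expresses [d n * b] through the other derivatives, which
   eliminates [d n] from the goal. *)
have := congr1 d e; rewrite !dM => de.
have dnb : d n * b = d a * m + a * d m - n * d b by rewrite de addrK.
have -> : (d n * m - n * d m) * (b * b) = d n * b * (m * b) - n * b * (d m * b) by ring.
by rewrite dnb -e; transitivity ((d a * b) * (m * m) - n * b * (d b * m)); [|rewrite -e]; ring.
Qed.

Lemma frac_der_tofrac a : frac_der a%:F = (d a)%:F.
Proof.
have d1 : d 1 = 0 by apply: (addrI (d 1)); rewrite addr0 -[RHS](congr1 d (mulr1 1)) dM mulr1 mul1r.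
by rewrite -[a%:F]divr1 -tofrac1 frac_derE ?oner_neq0 // d1 mulr0 subr0 !mulr1 tofrac1 divr1.
Qed.

Lemma frac_derD : {morph frac_der : x y / x + y}.
Proof.
move=> x y; have [a [b [b0 ->]]] := frac_ex x; have [c [e [e0 ->]]] := frac_ex y.
rewrite addf_div ?tofrac_eq0 // -!tofracM -tofracD !frac_derE ?mulf_neq0 //.
rewrite addf_div ?tofrac_eq0 ?mulf_neq0 //.
apply/eqP; rewrite eqr_div ?tofrac_eq0 ?mulf_neq0 ?tofrac_eq0 ?mulf_neq0 //.
rewrite -!tofracM -tofracD -!tofracM tofrac_eq; apply/eqP; rewrite dD !dM; ring.
Qed.

Lemma frac_derM x y : frac_der (x * y) = frac_der x * y + x * frac_der y.
Proof.
have [a [b [b0 ->]]] := frac_ex x; have [c [e [e0 ->]]] := frac_ex y.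
rewrite mulf_div -!tofracM !frac_derE ?mulf_neq0 //.
rewrite !mulf_div addf_div ?mulf_neq0 ?tofrac_eq0 ?mulf_neq0 //.
apply/eqP; rewrite -!tofracM -!tofracD eqr_div ?tofrac_eq0 ?mulf_neq0 ?tofrac_eq0 ?mulf_neq0 //.
rewrite -!tofracM tofrac_eq; apply/eqP; rewrite !dM; ring.
Qed.

(** Both products in the numerator of the quotient rule have weight at most [w a * w b], and the
    denominator has weight [w b * w b]. *)
Lemma frac_der_le x : (frac_abs (frac_der x) <= frac_abs x)%Re.
Proof.
have [a [b [b0 ->]]] := frac_ex x; rewrite frac_derE // !frac_absE ?mulf_neq0 //.
have h := w_gt0 b0; have i := Rinv_0_lt_compat _ h.
have -> : (w a / w b = w a * w b / w (b * b))%Re.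
  by rewrite wM /Rdiv Rinv_mult Rmult_assoc -(Rmult_assoc (w b)) Rinv_r; lra.
apply: Rmult_le_compat_r; first by rewrite wM Rinv_mult; nra.
have wN c : w (- c) = w c.
  have e : w (-1) = 1%Re.
    by have := wM (-1) (-1); rewrite mulrNN mulr1 w1 => e; have := w_ge0 (-1); nra.
  by rewrite -mulN1r wM e Rmult_1_l.
apply: Rle_trans (wD _ _) _; rewrite wN !wM; have := w_ge0 a.
by have := d_le a; have := d_le b; have := w_ge0 b => *; apply: Rmax_lub; nra.
Qed.
End FractionAbs.

(** * Degree and partial derivatives of polynomials *)

Module PolynomialDegree.
Import mathcomp.multinomials.mpoly.
Section PolynomialDegree.
Variables (F : fieldType) (n : nat).
Local Notation A := {mpoly F[n.+1]}.
Implicit Types f g : A.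

(** [msize] is the total degree plus one for nonzero polynomials, hence the predecessor. Division by
    [n.+1] makes the norms of the variables tend to 1 and the value groups ever finer as [n]
    grows. *)
Definition wdeg f : R := if f == 0 then 0%Re else exp (INR (msize f).-1 / INR n.+1).

Lemma INRn_gt0 : (0 < INR n.+1)%Re.
Proof. by apply: lt_0_INR; lia. Qed.

Lemma wdeg_neq0 f : f != 0 -> wdeg f = exp (INR (msize f).-1 / INR n.+1).
Proof. by rewrite /wdeg => /negPf ->. Qed.

Lemma wdeg0 : wdeg 0 = 0%Re.
Proof. by rewrite /wdeg eqxx. Qed.

Lemma wdeg_ge0 f : (0 <= wdeg f)%Re.
Proof. by rewrite /wdeg; case: ifP => _; [lra | apply: Rlt_le; apply: exp_pos]. Qed.

Lemma wdeg_eq0 f : wdeg f = 0%Re <-> f = 0.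
Proof.
split=> [|->]; last exact: wdeg0.
by rewrite /wdeg; case: eqP => // _ h; have := exp_pos (INR (msize f).-1 / INR n.+1); lra.
Qed.

Lemma wdeg_le f g : (msize f <= msize g)%N -> (wdeg f <= wdeg g)%Re.
Proof.
move=> h; have [->|f0] := eqVneq f 0; first by rewrite wdeg0; apply: wdeg_ge0.
have g0 : g != 0.
  by apply: contraNneq f0 => g0; move: h; rewrite g0 msize0 leqn0 msize_poly_eq0.
rewrite !wdeg_neq0 //.
have : (INR (msize f).-1 / INR n.+1 <= INR (msize g).-1 / INR n.+1)%Re.
  apply: Rmult_le_compat_r; first by apply: Rlt_le; apply: Rinv_0_lt_compat; apply: INRn_gt0.
  by apply: le_INR; move: (msize f) (msize g) h => a b; lia.
by case=> [/exp_increasing|->]; lra.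
Qed.

Lemma wdegD f g : (wdeg (f + g) <= Rmax (wdeg f) (wdeg g))%Re.
Proof.
have := msizeD_le f g; rewrite leq_max => /orP[] /wdeg_le h.
  exact: Rle_trans h (Rmax_l _ _).
exact: Rle_trans h (Rmax_r _ _).
Qed.

Lemma wdegM f g : wdeg (f * g) = (wdeg f * wdeg g)%Re.
Proof.
have [->|f0] := eqVneq f 0; first by rewrite mul0r wdeg0; lra.
have [->|g0] := eqVneq g 0; first by rewrite mulr0 wdeg0; lra.
rewrite !wdeg_neq0 ?mulf_neq0 // -exp_plus msizeM //; congr exp.
rewrite -Rdiv_plus_distr -plus_INR; congr (INR _ / _)%Re.
have : (msize f != 0)%N by rewrite msize_poly_eq0.
have : (msize g != 0)%N by rewrite msize_poly_eq0.
by move: (msize f) (msize g) => a b; lia.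
Qed.

Lemma wdeg_mderiv i f : (wdeg f^`M(i) <= wdeg f)%Re.
Proof.
apply: wdeg_le; rewrite /mderiv; apply: leq_trans (mmeasure_sum _ _ _ _) _.
apply/bigmax_leqP_seq => m mf _; apply: leq_trans (msizeZ_le _ _) _.
by rewrite msizeX; apply: leq_ltn_trans (mdegB _ _) _; apply: msize_mdeg_lt.
Qed.

Lemma wdegX (i : 'I_n.+1) : wdeg 'X_i = exp (/ INR n.+1).
Proof.
rewrite wdeg_neq0; first by rewrite msizeX mdeg1 /= /Rdiv Rmult_1_l.
by rewrite -msize_poly_eq0 msizeX.
Qed.

(** The index ranges over all naturals, with value 0 beyond [n], so that each [j] gives a sequence
    of operators over all [n]. *)
Definition pder (j : nat) f : A := if insub j is Some i then f^`M(i) else 0.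
Definition pvar (j : nat) : A := if insub j is Some i then 'X_i else 0.

Lemma pderD j : {morph pder j : f g / f + g}.
Proof. by move=> f g; rewrite /pder; case: insubP => [i _ _|_]; rewrite ?mderivD ?addr0. Qed.

Lemma pderM j f g : pder j (f * g) = pder j f * g + f * pder j g.
Proof.
by rewrite /pder; case: insubP => [i _ _|_]; rewrite ?mderivM // mul0r mulr0 addr0.
Qed.

Lemma wdeg_pder j f : (wdeg (pder j f) <= wdeg f)%Re.
Proof.
rewrite /pder; case: insubP => [i _ _|_]; first exact: wdeg_mderiv.
by rewrite wdeg0; apply: wdeg_ge0.
Qed.

Lemma pder_pvar i j : (i <= n)%N -> (j <= n)%N -> pder i (pvar j) = (i == j)%:R.
Proof.
rewrite -[(i <= n)%N]/(i < n.+1)%N -[(j <= n)%N]/(j < n.+1)%N => hi hj.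
rewrite /pder /pvar !insubT.
rewrite mderivX mnm1E -val_eqE !SubK eq_sym; case: eqVneq => [e|_]; last by rewrite scale0r.
subst j; rewrite (bool_irrelevance hj hi) scale1r -mpolyX0; congr 'X_[_].
by apply/mnmP => l; rewrite mnmBE subnn mnm0E.
Qed.

Lemma wdeg_pvar0 : wdeg (pvar 0) = exp (/ INR n.+1).
Proof. by rewrite /pvar insubT; apply: wdegX. Qed.

Lemma wdeg_pvar j : (wdeg (pvar j) <= exp (/ INR n.+1))%Re.
Proof.
rewrite /pvar; case: insubP => [i _ _|_]; first by rewrite wdegX; lra.
by rewrite wdeg0; apply: Rlt_le; apply: exp_pos.
Qed.

End PolynomialDegree.

(** These are the factors of the ultralimit. The relation between derivations and variables holds
    for [n] large with respect to [i] and [j], hence on a set of any free ultrafilter. *)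
Lemma base_fields p : prime p ->
  exists (K : nat -> fieldType) (v : forall n, K n -> R)
         (d : nat -> forall n, K n -> K n) (x : nat -> forall n, K n),
  [/\ forall n, p \in [pchar (K n)],
      forall n, is_nonarch_abs (@v n),
      forall j n, [/\ {morph d j n : a b / a + b},
                      forall a b, d j n (a * b) = d j n a * b + a * d j n b &
                      forall a, (v n (d j n a) <= v n a)%Re],
      forall i j n, (i <= n)%N -> (j <= n)%N -> d i n (x j n) = (i == j)%:R &
      forall n, v n (x 0%N n) = exp (/ INR n.+1) /\
                forall j, (v n (x j n) <= exp (/ INR n.+1))%Re].
Proof.
move=> p_prime.
pose A n : idomainType := {mpoly 'F_p[n.+1]}.
exists (fun n => {fraction A n}), (fun n => frac_abs (@wdeg 'F_p n)).
exists (fun j n => frac_der (@pder 'F_p n j)).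
exists (fun j n => (pvar 'F_p n j)%:F).
have ge0 n := @wdeg_ge0 'F_p n.
have eq0 n := @wdeg_eq0 'F_p n.
have wD n := @wdegD 'F_p n.
have wM n := @wdegM 'F_p n.
have dD n j := @pderD 'F_p n j.
have dM n j := @pderM 'F_p n j.
split.
- move=> n; have : p \in [pchar 'F_p] by apply: pchar_Fp.
  rewrite !inE => /andP[-> /eqP h] /=; apply/eqP.
  have : (p%:R : A n) = 0 by rewrite -mpolyC_nat h mpolyC0.
  by move/(congr1 (@FracField.tofrac _)); rewrite rmorph_nat tofrac0.
- by move=> n; apply: frac_absP.
- move=> j n; split=> [||a]; first exact: (frac_derD (dD n j) (dM n j)).
    exact: (frac_derM (dM n j)).
  exact: (frac_der_le (@ge0 n) (@eq0 n) (@wD n) (@wM n) (@dM n j) (@wdeg_pder 'F_p n j)).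
- move=> i j n hi hj; rewrite (frac_der_tofrac (@dM n i)).
  by rewrite pder_pvar // rmorph_nat.
- move=> n; have E := frac_abs_tofrac (@ge0 n) (@eq0 n) (@wM n).
  by split=> [|j]; rewrite E; [apply: wdeg_pvar0 | apply: wdeg_pvar].
Qed.
End PolynomialDegree.

(** * Ultralimits of valued fields *)

Lemma exists_INR_floor (y : R) : (0 <= y)%Re -> exists m : nat, (INR m <= y < INR m + 1)%Re.
Proof.
move=> y0; have [h1 h2] := archimed y.
have h3 : Z.lt Z0 (up y) by apply: lt_IZR; lra.
exists (Z.to_nat (Z.sub (up y) (Zpos xH))).
rewrite INR_IZR_INZ Znat.Z2Nat.id; last by lia.
by rewrite minus_IZR; lra.
Qed.

Record free_ultrafilter (U : (nat -> Prop) -> Prop) : Prop := FreeUltrafilter {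
  ultra_mono : forall P Q : nat -> Prop, (forall n, P n -> Q n) -> U P -> U Q;
  ultra_and : forall P Q : nat -> Prop, U P -> U Q -> U (fun n => P n /\ Q n);
  ultra_em : forall P : nat -> Prop, U P \/ U (fun n => ~ P n);
  ultra_false : ~ U (fun => False);
  ultra_ge : forall m, U (fun n => (m <= n)%N) }.

(** The ultrafilter lemma is applied to the filter of cofinite sets; containing all tails is what
    makes the result free. *)
Lemma free_ultrafilter_ex : exists U, free_ultrafilter U.
Proof.
have [G [Gu Goo]] := filter.ultraFilterLemma filter.eventually_filter.
have Gp := @filter.ultra_proper _ _ Gu.
have Gf := @filter.filter_filter _ _ Gp.
exists G; split.
- by move=> P Q PQ; apply: filter.filterS.
- by move=> P Q; apply: filter.filterI.
- by move=> P; apply: filter.in_ultra_setVsetC.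
- exact: (@filter.filter_not_empty _ _ Gp).
- by move=> m; apply: Goo; exists m.
Qed.

(** * Limits of real sequences along an ultrafilter *)

Section UltraLimit.
Variable U : (nat -> Prop) -> Prop.
Hypothesis UP : free_ultrafilter U.
Implicit Types a b : nat -> R.

Lemma ultra_all (P : nat -> Prop) : (forall n, P n) -> U P.
Proof. by move=> h; apply: (ultra_mono UP) (ultra_ge UP 0) => n _; apply: h. Qed.

Lemma ultra_and_ex (P Q : nat -> Prop) : U P -> U Q -> exists n, P n /\ Q n.
Proof.
move=> hP hQ; apply: NNPP => h; apply: (ultra_false UP).
apply: (ultra_mono UP) (ultra_and UP hP hQ) => n PQ; apply: h.
by exists n.
Qed.

Definition ulim a l := forall eps, (0 < eps)%Re -> U (fun n => (Rabs (a n - l) < eps)%Re).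

Lemma ulim_ex a C : U (fun n => (0 <= a n <= C)%Re) -> exists l, ulim a l.
Proof.
(* The limit is the supremum of the [r] that bound the sequence from below on a set of [U]. *)
move=> hC; pose E r := U (fun n => (r <= a n)%Re).
have [l [l_ub l_lub]] : {l | is_lub E l}.
  apply: completeness.
    exists C => r hr; have [n [h1 h2]] := ultra_and_ex hC hr; lra.
  by exists 0%Re; apply: (ultra_mono UP) hC => n; lra.
exists l => eps e0.
have [r [hr lr]] : exists r, E r /\ (l - eps < r)%Re.
  apply: NNPP => h; have : (l <= l - eps)%Re; last by lra.
  by apply: l_lub => r hr; apply: Rnot_lt_le => h2; apply: h; exists r.
have hn : U (fun n => ~ (l + eps / 2 <= a n)%Re).
  by case: (ultra_em UP (fun n => (l + eps / 2 <= a n)%Re)) => // /l_ub; lra.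
apply: (ultra_mono UP) (ultra_and UP hr hn) => n [h1 h2].
by apply: Rabs_def1; lra.
Qed.

Lemma ulim_ge a l r : ulim a l -> U (fun n => (r <= a n)%Re) -> (r <= l)%Re.
Proof.
move=> al hr; apply: Rnot_lt_le => h.
have [n [h1 h2]] := ultra_and_ex (al (r - l)%Re ltac:(lra)) hr.
by have := Rabs_def2 _ _ h1; lra.
Qed.

Lemma ulim_le a l r : ulim a l -> U (fun n => (a n <= r)%Re) -> (l <= r)%Re.
Proof.
move=> al hr; apply: Rnot_lt_le => h.
have [n [h1 h2]] := ultra_and_ex (al (l - r)%Re ltac:(lra)) hr.
by have := Rabs_def2 _ _ h1; lra.
Qed.

Lemma ulim_lt a l r : ulim a l -> (l < r)%Re -> U (fun n => (a n < r)%Re).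
Proof.
move=> al h; apply: (ultra_mono UP) (al (r - l)%Re ltac:(lra)) => n h1.
by have := Rabs_def2 _ _ h1; lra.
Qed.

Lemma ulim_gt a l r : ulim a l -> (r < l)%Re -> U (fun n => (r < a n)%Re).
Proof.
move=> al h; apply: (ultra_mono UP) (al (l - r)%Re ltac:(lra)) => n h1.
by have := Rabs_def2 _ _ h1; lra.
Qed.

Lemma ulimM a b l m : (0 <= l)%Re -> (0 <= m)%Re -> ulim a l -> ulim b m ->
  ulim (fun n => a n * b n)%Re (l * m)%Re.
Proof.
move=> l0 m0 al bm eps e0.
pose q := (eps / (l + m + 1))%Re; pose delta := Rmin 1 q.
have q0 : (0 < q)%Re by apply: Rdiv_lt_0_compat; lra.
have d0 : (0 < delta)%Re by apply: Rmin_pos; lra.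
have d1 : (delta <= 1)%Re by apply: Rmin_l.
have dq : (delta <= q)%Re by apply: Rmin_r.
have qe : (q * (l + m + 1) = eps)%Re by rewrite /q; field; lra.
apply: (ultra_mono UP) (ultra_and UP (al _ d0) (bm _ d0)) => n [h1 h2].
have -> : (a n * b n - l * m = (a n - l) * b n + l * (b n - m))%Re by ring.
have hb : (Rabs (b n) <= m + 1)%Re.
  by have := Rabs_def2 _ _ h2 => h; apply: Rabs_le; lra.
apply: Rle_lt_trans (Rabs_triang _ _) _; rewrite !Rabs_mult (Rabs_pos_eq l) //.
have h3 : (Rabs (a n - l) * Rabs (b n) <= Rabs (a n - l) * (m + 1))%Re.
  by apply: Rmult_le_compat_l => //; apply: Rabs_pos.
have h4 : (Rabs (a n - l) * (m + 1) < delta * (m + 1))%Re by apply: Rmult_lt_compat_r; lra.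
have h5 : (l * Rabs (b n - m) <= l * delta)%Re by apply: Rmult_le_compat_l; lra.
have h6 : (delta * (l + m + 1) <= eps)%Re by rewrite -qe; apply: Rmult_le_compat_r; lra.
by lra.
Qed.

Lemma ultra_exp_inv_lt r : (1 < r)%Re -> U (fun n => (exp (/ INR n.+1) < r)%Re).
Proof.
move=> r1; have l0 : (0 < ln r)%Re by rewrite -ln_1; apply: ln_increasing; lra.
have [m [hm m0]] := archimed_cor1 _ l0.
apply: (ultra_mono UP) (ultra_ge UP m) => n mn.
rewrite -[r]exp_ln; last by lra.
apply: exp_increasing; apply: Rle_lt_trans hm; apply: Rinv_le_contravar.
  exact: lt_0_INR.
by apply: le_INR; lia.
Qed.

(** * Bounded sequences and their limit norm *)

Variables (K : nat -> fieldType) (v : forall n, K n -> R).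
Hypothesis vP : forall n, is_nonarch_abs (@v n).

Definition seqs : Type := forall n, K n.
HB.instance Definition _ := gen_eqMixin seqs.
HB.instance Definition _ := gen_choiceMixin seqs.

Definition seqs_add (x y : seqs) : seqs := fun n => x n + y n.
Definition seqs_opp (x : seqs) : seqs := fun n => - x n.
Definition seqs_mul (x y : seqs) : seqs := fun n => x n * y n.

Fact seqs_addA : associative seqs_add.
Proof. by move=> x y z; apply: functional_extensionality_dep => n; apply: addrA. Qed.
Fact seqs_addC : commutative seqs_add.
Proof. by move=> x y; apply: functional_extensionality_dep => n; apply: addrC. Qed.
Fact seqs_add0 : left_id ((fun => 0) : seqs) seqs_add.
Proof. by move=> x; apply: functional_extensionality_dep => n; apply: add0r. Qed.
Fact seqs_addN : left_inverse ((fun => 0) : seqs) seqs_opp seqs_add.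
Proof. by move=> x; apply: functional_extensionality_dep => n; apply: addNr. Qed.
HB.instance Definition _ := GRing.isZmodule.Build seqs seqs_addA seqs_addC seqs_add0 seqs_addN.

Fact seqs_mulA : associative seqs_mul.
Proof. by move=> x y z; apply: functional_extensionality_dep => n; apply: mulrA. Qed.
Fact seqs_mulC : commutative seqs_mul.
Proof. by move=> x y; apply: functional_extensionality_dep => n; apply: mulrC. Qed.
Fact seqs_mul1 : left_id ((fun => 1) : seqs) seqs_mul.
Proof. by move=> x; apply: functional_extensionality_dep => n; apply: mul1r. Qed.
Fact seqs_mulD : left_distributive seqs_mul +%R.
Proof. by move=> x y z; apply: functional_extensionality_dep => n; apply: mulrDl. Qed.
Fact seqs_1_neq0 : ((fun => 1) : seqs) != 0.
Proof. by apply/eqP => /(congr1 (fun x : seqs => x 0%N)) /eqP; rewrite oner_eq0. Qed.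
HB.instance Definition _ :=
  GRing.Zmodule_isComNzRing.Build seqs seqs_mulA seqs_mulC seqs_mul1 seqs_mulD seqs_1_neq0.

Definition bdd (x : seqs) := exists C, U (fun n => (v (x n) <= C)%Re).
Definition bddb : {pred seqs} := fun x => `[< bdd x >].

Lemma bddP x : reflect (bdd x) (x \in bddb).
Proof. exact: asboolP. Qed.

Lemma bdd_subring_closed : subring_closed bddb.
Proof.
split=> [|x y /bddP[C hC] /bddP[C' hC']|x y /bddP[C hC] /bddP[C' hC']]; apply/bddP.
- by exists 1%Re; apply: ultra_all => n; rewrite (abs1 (vP n)); lra.
- exists (Rmax C C'); apply: (ultra_mono UP) (ultra_and UP hC hC') => n [h1 h2].
  by apply: (absB_le (vP n)); [apply: Rle_trans h1 (Rmax_l _ _) | apply: Rle_trans h2 (Rmax_r _ _)].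
- exists (C * C')%Re; apply: (ultra_mono UP) (ultra_and UP hC hC') => n [h1 h2].
  rewrite (absM (vP n)); apply: Rmult_le_compat => //; exact: (abs_ge0 (vP n)).
Qed.

HB.instance Definition _ := GRing.isSubringClosed.Build seqs bddb bdd_subring_closed.

Record bseq := BSeq { bval : seqs; _ : bval \in bddb }.
HB.instance Definition _ := [isSub for bval].
HB.instance Definition _ := [Choice of bseq by <:].
HB.instance Definition _ := [SubChoice_isSubComNzRing of bseq by <:].
HB.instance Definition _ := GRing.RMorphism.copy bval (val : bseq -> seqs).
Bind Scope ring_scope with bseq.
Implicit Types x y z : bseq.

Lemma bseq_ulim_ex x : exists l, ulim (fun n => v (bval x n)) l.
Proof.
have /bddP[C hC] := valP x; apply: (@ulim_ex _ C).
by apply: (ultra_mono UP) hC => n h; split=> //; apply: (abs_ge0 (vP n)).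
Qed.

Definition norm x : R := sval (cid (bseq_ulim_ex x)).

Lemma normP x : ulim (fun n => v (bval x n)) (norm x).
Proof. by rewrite /norm; case: cid. Qed.

Lemma norm_le x r : U (fun n => (v (bval x n) <= r)%Re) -> (norm x <= r)%Re.
Proof. exact: (ulim_le (normP x)). Qed.

Lemma norm_ge x r : U (fun n => (r <= v (bval x n))%Re) -> (r <= norm x)%Re.
Proof. exact: (ulim_ge (normP x)). Qed.

Lemma norm_lt x r : (norm x < r)%Re -> U (fun n => (v (bval x n) < r)%Re).
Proof. exact: (ulim_lt (normP x)). Qed.

Lemma norm_gt x r : (r < norm x)%Re -> U (fun n => (r < v (bval x n))%Re).
Proof. exact: (ulim_gt (normP x)). Qed.

Lemma norm_ge0 x : (0 <= norm x)%Re.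
Proof. by apply: norm_ge; apply: ultra_all => n; apply: (abs_ge0 (vP n)). Qed.

Lemma norm_ulim x l : ulim (fun n => v (bval x n)) l -> norm x = l.
Proof.
move=> xl; apply: Rle_antisym; apply: Rnot_lt_le => h.
  have hm : ((norm x + l) / 2 < norm x)%Re by lra.
  suff /(ulim_ge xl) : U (fun n => ((norm x + l) / 2 <= v (bval x n))%Re) by lra.
  by apply: (ultra_mono UP) (norm_gt hm) => n; apply: Rlt_le.
have hm : ((norm x + l) / 2 < l)%Re by lra.
suff /norm_ge : U (fun n => ((norm x + l) / 2 <= v (bval x n))%Re) by lra.
by apply: (ultra_mono UP) (ulim_gt xl hm) => n; apply: Rlt_le.
Qed.

Lemma norm_ae0 x : U (fun n => bval x n = 0) -> norm x = 0%Re.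
Proof.
move=> h; apply: Rle_antisym (norm_ge0 x); apply: norm_le.
by apply: (ultra_mono UP) h => n ->; rewrite (abs0 (vP n)); lra.
Qed.

Lemma normD x y : (norm (x + y) <= Rmax (norm x) (norm y))%Re.
Proof.
apply: Rnot_lt_le => h; set r := Rmax _ _ in h.
have hx := @norm_lt x ((norm (x + y) + r) / 2)%Re
  ltac:(have := Rmax_l (norm x) (norm y); rewrite -/r; lra).
have hy := @norm_lt y ((norm (x + y) + r) / 2)%Re
  ltac:(have := Rmax_r (norm x) (norm y); rewrite -/r; lra).
suff /norm_le : U (fun n => (v (bval (x + y) n) <= (norm (x + y) + r) / 2)%Re) by lra.
apply: (ultra_mono UP) (ultra_and UP hx hy) => n [h1 h2].
by apply: (absD_le (vP n)); apply: Rlt_le.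
Qed.

Lemma normM x y : norm (x * y) = (norm x * norm y)%Re.
Proof.
apply: norm_ulim.
have := ulimM (norm_ge0 x) (norm_ge0 y) (normP x) (normP y).
by move=> h eps /h; apply: (ultra_mono UP) => n; rewrite -(absM (vP n)).
Qed.

Lemma norm1 : norm 1 = 1%Re.
Proof.
apply: Rle_antisym; [apply: norm_le | apply: norm_ge]; apply: ultra_all => n.
  exact: Req_le (abs1 (vP n)).
exact: Req_le_sym (abs1 (vP n)).
Qed.

Lemma normN x : norm (- x) = norm x.
Proof.
apply: norm_ulim => eps /(normP x); apply: (ultra_mono UP) => n.
by rewrite -(absN (vP n) (bval x n)).
Qed.

(** * The quotient field by null sequences *)

Definition null : {pred bseq} := fun x => `[< norm x = 0%Re >].

Lemma nullP x : reflect (norm x = 0%Re) (x \in null).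
Proof. exact: asboolP. Qed.

Lemma null_idealr_closed : idealr_closed null.
Proof.
split; first by apply/nullP/norm_ae0; apply: ultra_all.
  by apply/negP => /nullP; rewrite norm1; lra.
move=> a x y /nullP hx /nullP hy; apply/nullP.
apply: Rle_antisym (norm_ge0 _); apply: Rle_trans (normD _ _) _.
by rewrite normM hx hy Rmult_0_r; apply: Rmax_lub; lra.
Qed.

HB.instance Definition _ := isIdealr.Build bseq null null_idealr_closed.

Definition ulimit := {ideal_quot null}.
HB.instance Definition _ := GRing.ComNzRing.on ulimit.
Local Notation pi := (\pi_ulimit%qT : bseq -> ulimit).

Lemma pi_eq x y : norm (x - y) = 0%Re -> pi x = pi y.
Proof. by move=> h; apply/eqP; rewrite -Quotient.idealrBE; apply/nullP. Qed.

Lemma pi_norm x y : pi x = pi y -> norm (x - y) = 0%Re.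
Proof. by move=> /eqP h; apply/nullP; rewrite Quotient.idealrBE. Qed.

Bind Scope ring_scope with ulimit.
Definition unorm (q : ulimit) : R := norm (repr q).

Lemma norm_congr x y : norm (x - y) = 0%Re -> norm x = norm y.
Proof.
have le z t : norm (z - t) = 0%Re -> (norm z <= norm t)%Re.
  move=> h; have := normD (z - t) t; rewrite subrK h Rmax_right //; exact: norm_ge0.
move=> h; apply: Rle_antisym; apply: le => //.
by rewrite -normN opprB.
Qed.

Lemma unorm_pi x : unorm (pi x) = norm x.
Proof. by apply: norm_congr; apply: pi_norm; rewrite reprK. Qed.

Lemma unorm0 : unorm 0 = 0%Re.
Proof. by rewrite -(rmorph0 pi) unorm_pi; apply: norm_ae0; apply: ultra_all. Qed.

Lemma unorm_eq0 q : unorm q = 0%Re -> q = 0.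
Proof.
move=> h; rewrite -[q]reprK -(rmorph0 pi); apply: pi_eq.
by rewrite subr0.
Qed.

(** On a set of [U] the terms of [x] exceed half its norm, so the termwise inverse is bounded there;
    wherever a term is 0, its inverse is 0 by convention. *)
Lemma bseq_inv x : norm x <> 0%Re -> exists y, norm (y * x - 1) = 0%Re.
Proof.
move=> x0; have nx : (0 < norm x)%Re by have := norm_ge0 x; lra.
have hx := @norm_gt x (norm x / 2)%Re ltac:(lra).
have ne n : (norm x / 2 < v (bval x n))%Re -> bval x n <> 0.
  by move=> + h; rewrite h (abs0 (vP n)); lra.
pose y : seqs := fun n => (bval x n)^-1.
have yb : y \in bddb.
  apply/bddP; exists (/ (norm x / 2))%Re; apply: (ultra_mono UP) hx => n h.
  rewrite (absV (vP n)); last exact: ne.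
  by apply: Rinv_le_contravar; lra.
exists (BSeq yb); apply: norm_ae0; apply: (ultra_mono UP) hx => n h.
by apply/eqP; rewrite subr_eq0; apply/eqP/mulVf/eqP/ne.
Qed.

Definition uinv (q : ulimit) : ulimit :=
  if pselect (norm (repr q) <> 0%Re) is left h then pi (sval (cid (bseq_inv h))) else 0.

Lemma uinvP q : q != 0 -> uinv q * q = 1.
Proof.
move=> q0; rewrite /uinv; case: pselect => [h|h]; last first.
  by case/eqP: q0; apply: unorm_eq0; apply: NNPP.
case: cid => y /= hy; rewrite -{1}[q]reprK -(rmorph1 pi) -rmorphM; exact: pi_eq.
Qed.

Lemma uinv0 : uinv 0 = 0.
Proof. by rewrite /uinv; case: pselect => // h; case: h; apply: unorm0. Qed.

HB.instance Definition _ := GRing.ComNzRing_isField.Build ulimit uinvP uinv0.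

Lemma unormP : is_nonarch_abs (unorm : ulimit -> R).
Proof.
split=> [q|]; first exact: norm_ge0.
split=> [q|]; first by split=> [|->]; [apply: unorm_eq0 | apply: unorm0].
split=> q r; rewrite -[q]reprK -[r]reprK.
  by rewrite -rmorphD !unorm_pi; apply: normD.
by rewrite -rmorphM !unorm_pi; apply: normM.
Qed.

Lemma unorm_spherical (e : nat -> ulimit) (r : nat -> R) :
  (forall i j, (i <= j)%N -> (unorm (e j - e i) <= r i)%Re) ->
  exists w, forall i, (unorm (w - e i) <= r i)%Re.
Proof.
move=> he; pose E i := repr (e i).
have eE i : e i = pi (E i) by rewrite reprK.
have EN i j : (i <= j)%N -> (norm (E j - E i) <= r i)%Re.
  by move=> /he; rewrite !eE -rmorphB unorm_pi.
have ip (m : nat) : (0 < / INR m.+1)%Re by apply: Rinv_0_lt_compat; apply: lt_0_INR; lia.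
(* [A m n] says that at coordinate [n] the element [E m] lies in the first balls, up to the error
   [/ INR m.+1]. As finitely many conditions are involved, it holds for a set of [n] in [U]. *)
pose A m n := forall i, (i <= m)%N -> (v (bval (E m) n - bval (E i) n) <= r i + / INR m.+1)%Re.
have UA m : U (A m).
  have h l : (l <= m)%N -> U (fun n => forall i, (i <= l)%N ->
      (v (bval (E m) n - bval (E i) n) <= r i + / INR m.+1)%Re).
    have h1 i : (i <= m)%N ->
        U (fun n => (v (bval (E m) n - bval (E i) n) <= r i + / INR m.+1)%Re).
      move=> im; have h2 := @norm_lt (E m - E i) (r i + / INR m.+1)%Re
        ltac:(have := EN _ _ im; have := ip m; lra).
      by apply: (ultra_mono UP) h2 => n; apply: Rlt_le.
    elim: l => [|l IH] lm.
      by apply: (ultra_mono UP) (h1 _ lm) => n hn i; rewrite leqn0 => /eqP ->.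
    apply: (ultra_mono UP) (ultra_and UP (IH (ltnW lm)) (h1 _ lm)) => n [hn1 hn2] i.
    by rewrite leq_eqVlt => /orP[/eqP -> //|]; apply: hn1.
  exact: h (leqnn m).
(* The diagonal choice: at coordinate [n] take the term of [E l] for the largest [l <= n] with
   [A l n], and 0 if there is none. *)
have w_ex n : exists y : K n, forall m, (m <= n)%N -> A m n ->
    exists2 m', (m <= m')%N & A m' n /\ y = bval (E m') n.
  have [[m [mn Am]]|no] := pselect (exists m, (m <= n)%N /\ A m n); last first.
    by exists 0 => m mn Am; case: no; exists m.
  have ex : exists m, (m <= n)%N && `[< A m n >] by exists m; rewrite mn; apply/asboolP.
  have ub m' : (m' <= n)%N && `[< A m' n >] -> (m' <= n)%N by case/andP.
  case: (ex_maxnP ex ub) => l /andP[ln /asboolP Al] max.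
  exists (bval (E l) n) => m' m'n Am'; exists l => //.
  by apply: max; rewrite m'n; apply/asboolP.
pose w : seqs := fun n => sval (cid (w_ex n)).
have wP n : forall m, (m <= n)%N -> A m n ->
    exists2 m', (m <= m')%N & A m' n /\ w n = bval (E m') n.
  by rewrite /w; case: cid.
(* For [n >= m] with [A m n], the chosen index is at least [m], so its error is at most
   [/ INR m.+1]. *)
have near i m : (i <= m)%N -> U (fun n => (v (w n - bval (E i) n) <= r i + / INR m.+1)%Re).
  move=> im; apply: (ultra_mono UP) (ultra_and UP (ultra_ge UP m) (UA m)) => n [mn Am].
  have [m' mm' [Am' ->]] := wP _ _ mn Am.
  apply: Rle_trans (Am' i _) _; first exact: leq_trans mm'.
  apply: Rplus_le_compat_l; apply: Rinv_le_contravar; first by apply: lt_0_INR; lia.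
  by apply: le_INR; lia.
have wb : w \in bddb.
  have /bddP[C hC] := valP (E 0%N); apply/bddP.
  exists (Rmax (r 0%N + / INR 1) C)%Re.
  apply: (ultra_mono UP) (ultra_and UP hC (near 0%N 0%N (leqnn _))) => n [h1 h2].
  rewrite -[w n](subrK (bval (E 0%N) n)); apply: (absD_le (vP n)).
    exact: Rle_trans h2 (Rmax_l _ _).
  exact: Rle_trans h1 (Rmax_r _ _).
exists (pi (BSeq wb)) => i; rewrite eE -rmorphB unorm_pi.
apply: Rnot_lt_le; set l := norm _ => h.
have [m [hm m0]] := @archimed_cor1 (l - r i) ltac:(lra).
have : (l <= _)%Re := norm_le (near i (m + i)%N (leq_addl _ _) :
  U (fun n => v (bval (BSeq wb - E i) n) <= _)%Re).
suff : (/ INR (m + i).+1 <= / INR m)%Re by lra.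
by apply: Rinv_le_contravar; [apply: lt_0_INR | apply: le_INR; lia].
Qed.

(** * Derivations on the ultralimit *)

Section Derivation.
Variable d : forall n, K n -> K n.
Hypothesis dD : forall n, {morph d (n:=n) : a b / a + b}.
Hypothesis dM : forall n (a b : K n), d (a * b) = d a * b + a * d b.
Hypothesis d_le : forall n (a : K n), (v (d a) <= v a)%Re.

Lemma bder_subproof x : (fun n => d (bval x n)) \in bddb.
Proof.
have /bddP[C hC] := valP x; apply/bddP; exists C.
by apply: (ultra_mono UP) hC => n; apply: Rle_trans.
Qed.

Definition bder x : bseq := BSeq (bder_subproof x).
Definition uder (q : ulimit) : ulimit := pi (bder (repr q)).

Lemma bderD : {morph bder : x y / x + y}.
Proof.
by move=> x y; apply: val_inj; apply: functional_extensionality_dep => n; apply: dD.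
Qed.

Lemma bderM x y : bder (x * y) = bder x * y + x * bder y.
Proof. by apply: val_inj; apply: functional_extensionality_dep => n; apply: dM. Qed.

Lemma norm_bder x : (norm (bder x) <= norm x)%Re.
Proof.
apply: Rnot_lt_le => h.
have h1 := @norm_lt x ((norm x + norm (bder x)) / 2)%Re ltac:(lra).
suff /norm_le : U (fun n => (v (bval (bder x) n) <= (norm x + norm (bder x)) / 2)%Re) by lra.
apply: (ultra_mono UP) h1 => n /Rlt_le; apply: Rle_trans; exact: d_le.
Qed.

(** Contractivity makes [bder] preserve null sequences, so it descends to the quotient. *)
Lemma uder_pi x : uder (pi x) = pi (bder x).
Proof.
apply: pi_eq; set y := repr _.
have -> : bder y - bder x = bder (y - x).
  by apply: (addIr (bder x)); rewrite -bderD !subrK.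
apply: Rle_antisym (norm_ge0 _); apply: Rle_trans (norm_bder _) _.
by apply: Req_le; apply: pi_norm; rewrite reprK.
Qed.

Lemma uderD : {morph uder : q r / q + r}.
Proof.
by move=> q r; rewrite -[q]reprK -[r]reprK -rmorphD !uder_pi bderD rmorphD.
Qed.

Lemma uderM q r : uder (q * r) = uder q * r + q * uder r.
Proof. by rewrite -[q]reprK -[r]reprK -rmorphM !uder_pi bderM rmorphD !rmorphM. Qed.

Lemma unorm_uder q : (unorm (uder q) <= unorm q)%Re.
Proof. by rewrite -[q]reprK uder_pi !unorm_pi; apply: norm_bder. Qed.
End Derivation.

Lemma pchar_ulimit p : (forall n, p \in [pchar (K n)]) -> p \in [pchar ulimit].
Proof.
move=> pK; have := pK 0%N; rewrite !inE => /andP[-> _] /=; apply/eqP.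
rewrite -(rmorph_nat pi) -(rmorph0 pi); congr pi; apply: val_inj; rewrite rmorph_nat.
apply: functional_extensionality_dep => n.
have -> m : (m%:R : seqs) n = m%:R.
  by elim: m => [//|m IH]; rewrite !mulrS -IH.
exact: pcharf0.
Qed.

(** * The value group of the ultralimit *)

Variable x0 : seqs.
Hypothesis v_x0 : forall n, v (x0 n) = exp (/ INR n.+1).

(** For [s >= 1], let [m n] be the integer part of [INR n.+1 * ln s]. The power [x0 n ^+ m n] has
    norm between [s / exp (/ INR n.+1)] and [s], so the limit is [s]; norms below 1 come from
    inverses. *)
Lemma unorm_surj rho : (0 < rho)%Re -> exists t, unorm t = rho.
Proof.
have ge1 s : (1 <= s)%Re -> exists t, unorm t = s.
  move=> s1; have l0 : (0 <= ln s)%Re.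
    case: s1 => [h|<-]; last by rewrite ln_1; lra.
    by apply: Rlt_le; rewrite -ln_1; apply: ln_increasing; lra.
  have np n : (0 < INR n.+1)%Re by apply: lt_0_INR; lia.
  have fl n := @exists_INR_floor (INR n.+1 * ln s) ltac:(have := np n; nra).
  pose m n := sval (cid (fl n)).
  have mP n : (INR (m n) <= INR n.+1 * ln s < INR (m n) + 1)%Re by rewrite /m; case: cid.
  pose t : seqs := fun n => x0 n ^+ m n.
  have vt n : v (t n) = exp (INR (m n) * / INR n.+1).
    rewrite (absX (vP n)) v_x0; elim: (m n) => [|q IH].
      by rewrite /= Rmult_0_l exp_0.
    by rewrite -tech_pow_Rmult IH -exp_plus (S_INR q); congr exp; ring.
  have le_exp (a b : R) : (a <= b)%Re -> (exp a <= exp b)%Re.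
    by case=> [/exp_increasing|->]; lra.
  have vts n : (v (t n) <= s)%Re.
    rewrite vt -[s]exp_ln; last by lra.
    apply: le_exp; apply: (Rmult_le_reg_r (INR n.+1)) => //.
    rewrite Rmult_assoc Rinv_l; have := np n; have := mP n; lra.
  have svt n : (s <= v (t n) * exp (/ INR n.+1))%Re.
    rewrite vt -exp_plus -{1}[s]exp_ln; last by lra.
    apply: le_exp; apply: (Rmult_le_reg_r (INR n.+1)) => //.
    rewrite Rmult_plus_distr_r Rmult_assoc Rinv_l; have := np n; have := mP n; lra.
  have tb : t \in bddb by apply/bddP; exists s; apply: ultra_all.
  exists (pi (BSeq tb)); rewrite unorm_pi; apply: Rle_antisym.
    by apply: norm_le; apply: ultra_all.
  apply: Rnot_lt_le; set l := norm _ => h.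
  pose b := ((l + s) / 2)%Re; have l1 : (0 <= l)%Re by apply: norm_ge0.
  have q1 : (1 < s / b)%Re.
    by apply: (Rmult_lt_reg_r b); rewrite /Rdiv ?Rmult_assoc ?Rinv_l /b; lra.
  suff /norm_ge : U (fun n => (b <= v (bval (BSeq tb) n))%Re) by rewrite -/l /b; lra.
  apply: (ultra_mono UP) (ultra_exp_inv_lt q1) => n hn /=.
  have h1 := svt n; have h2 := exp_pos (/ INR n.+1).
  have h3 : (0 <= v (t n))%Re := abs_ge0 (vP n) _.
  have b0 : (0 < b)%Re by rewrite /b; lra.
  apply: Rnot_lt_le => h4.
  have : (v (t n) * exp (/ INR n.+1) < b * (s / b))%Re by apply: Rmult_le_0_lt_compat; lra.
  by have -> : (b * (s / b) = s)%Re by [field; lra]; lra.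
move=> r0; have [h|h] := Rle_or_lt 1 rho; first exact: ge1.
have [|t ht] := ge1 (/ rho)%Re; first by rewrite -Rinv_1; apply: Rinv_le_contravar; lra.
have i0 := Rinv_0_lt_compat _ r0.
have t0 : t <> 0 by move=> t0; move: ht; rewrite t0 unorm0; lra.
by exists t^-1; rewrite (absV unormP t0) ht Rinv_inv.
Qed.
End UltraLimit.

(** * Application to the ultralimit of rational function fields *)

Theorem theoremA :
  forall p : nat, prime p ->
  exists (k : fieldType) (abs : k -> R),
    p \in [pchar k] /\ is_nonarch_abs abs /\ abs_complete abs /\ abs_nontrivial abs /\
    forall n : nat, (0 < n)%N ->
      (forall phi : series k n -> series k n, p_inv_linear abs p phi ->
         forall x : series k n, tate abs x -> phi x = @szero k n) /\
      ~ frobenius_split abs n p.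
Proof.
move=> p p_prime; have [U UP] := free_ultrafilter_ex.
have [K [v [d [x [pcharK vP dP dx vxP]]]]] := PolynomialDegree.base_fields p_prime.
have vx0 n : v n (x 0%N n) = exp (/ INR n.+1) by case: (vxP n).
have vx j n : (v n (x j n) <= exp (/ INR n.+1))%Re by case: (vxP n).
have d_le j n (a : K n) : (v n (d j n a) <= v n a)%Re by case: (dP j n).
have dD j n : {morph d j n : a b / a + b} by case: (dP j n).
have dM j n a b : d j n (a * b) = d j n a * b + a * d j n b by case: (dP j n).
have xb j : x j \in bddb U v.
  apply/bddP; exists 2%Re; apply: (ultra_mono UP) (ultra_exp_inv_lt UP (_ : 1 < 2)%Re); last by lra.
  by move=> n /Rlt_le; apply: Rle_trans.
pose X j := \pi_(ulimit UP vP)%qT (BSeq (xb j)).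
apply: (@exists_valued_field_without_p_inv_linear_map p (ulimit UP vP)
  (@unorm U UP K v vP) (fun j => @uder U UP K v vP (d j) (d_le j)) X).
- exact: pchar_ulimit.
- exact: unormP.
- by move=> j; apply: uderD.
- by move=> j q r; apply: uderM.
- by move=> j q; apply: unorm_uder.
(* The norms of the [x j n] are at most [exp (/ INR n.+1)], which is eventually below any number
   greater than 1. *)
- move=> j; rewrite unorm_pi; apply: Rnot_lt_le; set l := norm _ _ _ => l1.
  have h : (1 < (1 + l) / 2)%Re by lra.
  suff /(@norm_le U UP K v vP) : U (fun n => (v n (bval (BSeq (xb j)) n) <= (1 + l) / 2)%Re).
    by rewrite -/l; lra.
  apply: (ultra_mono UP) (ultra_exp_inv_lt UP h) => n /Rlt_le; exact: Rle_trans (vx j n).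
- move=> i j; rewrite uder_pi // -(rmorph_nat (\pi_(ulimit UP vP)%qT)).
  (* The relation holds at every coordinate [n >= i + j], hence on a set of [U]. *)
  apply: pi_eq; apply: norm_ae0; apply: (ultra_mono UP) (ultra_ge UP (i + j)) => n ij.
  rewrite -[LHS]/(d i n (x j n) - bval ((i == j)%:R : bseq U v) n) dx; [|lia|lia].
  by case: (i == j); apply: subrr.
- exact: unorm_surj vx0.
- exact: unorm_spherical.
Qed.
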